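(* Let $\gamma>0$, let $t,r \ge 2$ be integers, and let $\alpha \in \left( \frac{r-2}{r-1},\frac{r-1}{r} \right]$. Let $G_\alpha$ be an $n$-vertex graph with $\delta(G_{\alpha})\geq \alpha n$, and let $p \ge n^{-2/(t+1)+\gamma}$. Then asymptotically almost surely the following holds: in the $(1:1)$ Maker-Breaker game played on the edges of $G_{\alpha}\cup G_{n,p}$, Maker has a strategy to claim a copy of $K_{tr}$.
   Context: $G_{n,p}$ denotes the binomial random graph on the vertex set of $G_\alpha$, each pair being an edge independently with probability $p$; $G_\alpha \cup G_{n,p}$ is the union of the edge sets. A.a.s. means with probability tending to $1$ as $n\to\infty$. In the $(1:1)$ Maker-Breaker game, Maker and Breaker alternately claim one previously unclaimed edge of the board each; Maker wins if she claims all edges of a copy of the target graph. *)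

(* Defs.v *)
From HB Require Import structures.
From mathcomp Require Import all_boot all_order all_algebra.
From mathcomp Require Import all_classical all_reals all_analysis.

Set Implicit Arguments.
Unset Strict Implicit.
Unset Printing Implicit Defensive.

Import Order.TTheory GRing.Theory Num.Theory.
Import numFieldNormedType.Exports.

Local Open Scope ring_scope.

Definition edge (T : finType) := {e : {set T} | #|e| == 2%N}.

(* A simple graph on T is its edge set, so the union of two graphs on the same
   vertex set is [:|:]. *)
Definition graph (T : finType) := {set edge T}.

Definition degree (T : finType) (G : graph T) (v : T) : nat :=
  #|[set e in G | v \in val e]|.

(* Every degree is less than #|T|, so the default value #|T| matters only when
   T is empty. *)
Definition min_degree (T : finType) (G : graph T) : nat :=
  \big[minn/#|T|]_(v : T) degree G v.

Definition complete_on (T : finType) (S : {set T}) : graph T :=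
  [set e : edge T | val e \subset S].

Definition contains_clique (T : finType) (k : nat) (G : graph T) : Prop :=
  exists S : {set T}, #|S| = k /\ complete_on S \subset G.

(* Probability that the binomial random graph on T with edge probability p
   satisfies A: the edges are independent Bernoulli(p) variables, so a graph H
   has as its probability the product of its edgewise factors. *)
Definition gnp_prob (R : realType) (T : finType) (p : R)
    (A : graph T -> Prop) : R :=
  \sum_(H : graph T | `[< A H >])
    \prod_(e : edge T) (if e \in H then p else 1 - p).

Inductive player := Maker | Breaker.

(* Whether Maker makes move number i (counted from 0). *)
Definition maker_turn (first : player) (i : nat) : bool :=
  match first with Maker => ~~ odd i | Breaker => odd i end.

(* A history lists the edges claimed so far, in chronological order. *)
Definition legal (T : finType) (board : graph T) (h : seq (edge T)) : Prop :=
  uniq h /\ {subset h <= board}.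

Definition complete_play (T : finType) (board : graph T)
    (h : seq (edge T)) : Prop :=
  uniq h /\ h =i board.

(* A strategy maps each history to Maker's next edge. *)
Definition strategy (T : finType) := seq (edge T) -> edge T.

(* Without this condition, a strategy proposing claimed or off-board edges
   would be consistent with no complete play, and so vacuously winning. *)
Definition legal_strategy (T : finType) (first : player) (board : graph T)
    (s : strategy T) : Prop :=
  forall h : seq (edge T), legal board h -> (size h < #|board|)%N ->
    maker_turn first (size h) -> s h \in board /\ s h \notin h.

Definition follows (T : finType) (first : player) (s : strategy T)
    (h : seq (edge T)) : Prop :=
  forall (h1 h2 : seq (edge T)) (e : edge T), h = h1 ++ e :: h2 ->
    maker_turn first (size h1) -> e = s h1.

Definition maker_edges (T : finType) (first : player)
    (h : seq (edge T)) : graph T :=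
  [set e | (e \in h) && maker_turn first (index e h)].

(* Maker has a winning strategy in the (1:1) game on the given board in which
   she wants to claim a copy of K_k. Play continues until the board is
   exhausted, which does not matter as claimed edges are never lost. *)
Definition maker_wins_clique (T : finType) (first : player) (board : graph T)
    (k : nat) : Prop :=
  exists s : strategy T,
    legal_strategy first board s /\
    forall h : seq (edge T), complete_play board h -> follows first s h ->
      contains_clique k (maker_edges first h).

(* Main.v *)
(** Maker plays the potential strategy of the Erdős–Selfridge–Beck criterion:
    with [weight] the sum of [2 ^ #|A i :&: M|] over the winning sets that
    Breaker has not touched, always taking the edge of largest weight costs her
    per round at most [2 ^ m] times the codegree of the two edges claimed.  So
    she wins if the winning sets outnumber the sum over all edges of the
    largest codegrees.

    The winning sets are the copies of K_(tr) whose cross edges between r parts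
    of size t lie in G_alpha and whose inner edges are random.  The minimum
    degree gives a positive density of K_r's in G_alpha; blowing them up part by
    part with the power-mean inequality gives a positive density of complete
    r-partite graphs with parts of size t.  With l = n^(gamma (t+1)/2), the
    condition on p says n^2 p^(t+1) >= l^2, and hence the expected number of
    copies through a fixed set S of at least three vertices is at most a
    proportion 1/(n^2 p l) of all copies if S lies in one part, and 1/(n^2 l)
    otherwise.  By a second moment computation and Markov's inequality, after
    discarding the few copies that meet too many others in three vertices, the
    codegrees are small enough: at most n^2 p l^(1/3) edges are random, and only
    these can be inner edges. *)
Require Import Defs.
From HB Require Import structures.
From mathcomp Require Import all_boot all_order all_algebra.
From mathcomp Require Import ring lra zify.

Import Order.TTheory GRing.Theory Num.Theory.

Set Implicit Arguments.
Unset Strict Implicit.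
Unset Printing Implicit Defensive.

Local Open Scope ring_scope.

(** * A criterion for Maker *)

Lemma disjoint_setU1 (U : finType) (y : U) (X Y : {set U}) :
  [disjoint X & y |: Y] = (y \notin X) && [disjoint X & Y].
Proof.
rewrite disjoint_sym [in RHS]disjoint_sym -disjointU1.
by apply: eq_disjoint => e; rewrite !inE.
Qed.

Section BeckCriterion.
Variables (R : realFieldType) (T I : finType) (F : {set I}) (A : I -> graph T).

Definition weight (M B : graph T) : nat :=
  (\sum_(i in F | [disjoint A i & B]) 2 ^ #|A i :&: M|)%N.

(** This is both the gain in weight when Maker claims [x] and the loss when Breaker claims it. *)
Definition weight_at (x : edge T) (M B : graph T) : nat :=
  (\sum_(i in F | [disjoint A i & B] && (x \in A i)) 2 ^ #|A i :&: M|)%N.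

Definition codegree (x y : edge T) : nat :=
  #|[set i in F | (x \in A i) && (y \in A i)]|.

Lemma weight_maker (x : edge T) (M B : graph T) : x \notin M ->
  weight (x |: M) B = (weight M B + weight_at x M B)%N.
Proof.
move=> xM; rewrite /weight /weight_at (bigID (fun i => x \in A i)) /=.
rewrite [in RHS](bigID (fun i => x \in A i)) /= addnAC; congr (_ + _)%N; last first.
  apply: eq_bigr => i /andP[_ xA]; congr (2 ^ #|pred_of_set _|)%N.
  apply/setP => e; rewrite !inE.
  by case: eqP => // ->; rewrite (negbTE xA).
rewrite -!(eq_bigl _ _ (fun i => andbA _ _ _)) -big_split /=.
apply: eq_bigr => i /and3P[_ _ xA].
by rewrite addnn -mul2n -expnS setIUr (setIidPr _) ?sub1set // cardsU1 !inE (negbTE xM) andbF.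
Qed.

Lemma weight_breaker (y : edge T) (M B : graph T) :
  weight M B = (weight M (y |: B) + weight_at y M B)%N.
Proof.
rewrite /weight /weight_at (bigID (fun i => y \in A i)) /= addnC.
congr (_ + _)%N; apply: eq_bigl => i; last by rewrite andbA.
by rewrite disjoint_setU1 -andbA; congr (_ && _); rewrite andbC.
Qed.

(** Among the sets through [y] only those that also contain [x] gain from Maker's move, and each of
    them weighs at most [2 ^ m] afterwards. *)
Lemma weight_at_maker (x y : edge T) (M B : graph T) (m : nat) :
  (forall i, #|A i| <= m)%N -> x \notin M ->
  (weight_at y (x |: M) B <= weight_at y M B + 2 ^ m * codegree x y)%N.
Proof.
move=> Am xM; rewrite /weight_at /codegree -sum1_card big_distrr /=.
under [X in (_ <= _ + X)%N]eq_bigl => i do rewrite inE.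
rewrite [X in (X <= _)%N](bigID (fun i => x \in A i)) /=.
rewrite addnC; apply: leq_add.
  rewrite [X in (_ <= X)%N](bigID (fun i => x \in A i)) /=.
  apply: leq_trans (leq_addl _ _).
  apply: leq_sum => i /andP[_ xA].
  rewrite leq_exp2l //; apply: subset_leq_card; apply/subsetP => e; rewrite !inE.
  by case: eqP => // ->; rewrite (negbTE xA).
rewrite [X in (_ <= X)%N](bigID (fun i => [disjoint A i & B])) /=.
apply: leq_trans (leq_addr _ _).
rewrite (eq_bigl (fun i => (i \in F) && ((x \in A i) && (y \in A i)) && [disjoint A i & B])).
  apply: leq_sum => i _; rewrite muln1 leq_exp2l //.
  by apply: leq_trans (Am i); apply: subset_leq_card; apply: subsetIl.
by move=> i; case: (_ \in F); case: [disjoint _ & _]; case: (x \in _); case: (y \in _).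
Qed.

Variables (beta : edge T -> R) (m : nat).
Hypothesis Am : forall i, (#|A i| <= m)%N.
Hypothesis codeg_beta : forall x y, x != y -> (codegree x y)%:R <= beta x.

(** Invariant before a move of Maker, with [U] the unclaimed edges: the weight exceeds a reserve of
    [2 ^+ m * beta x] per unclaimed edge [x], which pays for the round in which Maker claims [x]. *)
Definition winning (M B U : graph T) : Prop :=
  2 ^+ m * (\sum_(x in U) beta x) < (weight M B)%:R.

Lemma beta_ge0 (x y : edge T) : x != y -> 0 <= beta x.
Proof. by move=> xy; apply: le_trans (codeg_beta xy). Qed.

(* A round changes the weight by [weight_at x] minus [weight_at y] minus the
   sets containing both edges, which by then have gained from [x]. *)
Lemma winning_step (x y : edge T) (M B U : graph T) : x \notin M -> x \in U ->
  y \in U -> y != x -> (weight_at y M B <= weight_at x M B)%N ->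
  winning M B U -> winning (x |: M) (y |: B) (U :\ x :\ y).
Proof.
move=> xM xU yU yx le_yx; rewrite /winning => win.
have yUx : y \in U :\ x by rewrite !inE yx.
have ge : (weight M B <= weight (x |: M) (y |: B) + 2 ^ m * codegree x y)%N.
  have := weight_at_maker y B Am xM; have := weight_breaker y (x |: M) B.
  by rewrite weight_maker //; lia.
move: win ge; rewrite (big_setD1 x) //= (big_setD1 y) //= -(ler_nat R) natrD natrM natrX.
have xy : x != y by rewrite eq_sym.
have := beta_ge0 yx; have := codeg_beta xy.
set s := \sum_(_ in _) _; set k := (codegree x y)%:R => h1 h2 h3 h4.
have m0 : 0 < 2 ^+ m :> R by apply: exprn_gt0.
have h5 : 2 ^+ m * k <= 2 ^+ m * beta x by rewrite ler_pM2l.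
have h6 : 0 <= 2 ^+ m * beta y by rewrite mulr_ge0 // ltW.
by move: h3; rewrite !mulrDr => h3; lra.
Qed.


Lemma maker_edges_rcons (first : player) (h : seq (edge T)) (e : edge T) :
  e \notin h -> maker_edges first (rcons h e) =
    if maker_turn first (size h) then e |: maker_edges first h
    else maker_edges first h.
Proof.
move=> eh; apply/setP => x; rewrite inE mem_rcons inE -cats1 index_cat.
case: eqVneq => [->|xe]; last first.
  rewrite /=; case: (boolP (x \in h)) => xh /=; last first.
    by case: ifP; rewrite !inE ?(negbTE xe) ?(negbTE xh).
  by case: ifP; rewrite !inE ?(negbTE xe) ?xh.
by rewrite (negbTE eh) /= eqxx addn0; case: ifP; rewrite !inE (negbTE eh) ?eqxx.
Qed.

Definition breaker_edges (first : player) (h : seq (edge T)) : graph T :=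
  [set e in h] :\: maker_edges first h.

Lemma maker_edgesS (first : player) (h : seq (edge T)) :
  {subset maker_edges first h <= h}.
Proof. by move=> e; rewrite inE => /andP[]. Qed.

Lemma breaker_edges_rcons (first : player) (h : seq (edge T)) (e : edge T) :
  e \notin h -> breaker_edges first (rcons h e) =
    if maker_turn first (size h) then breaker_edges first h
    else e |: breaker_edges first h.
Proof.
move=> eh; rewrite /breaker_edges maker_edges_rcons //.
have eM : e \notin maker_edges first h by apply: contra eh => /maker_edgesS.
apply/setP => x; case: ifP => _; rewrite !in_setD !in_setU1 !in_set mem_rcons in_cons.
  case: eqVneq => [->|] //=; by rewrite (negbTE eh) andbF.
by case: eqVneq => [->|] //=; move: eM; rewrite inE => ->.
Qed.

Variable board : graph T.

Definition unclaimed (h : seq (edge T)) : graph T := board :\: [set e in h].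

Lemma unclaimed_rcons (h : seq (edge T)) (e : edge T) :
  unclaimed (rcons h e) = unclaimed h :\ e.
Proof. by apply/setP => x; rewrite !inE mem_rcons inE negb_or andbA. Qed.

(** The value [e0] is returned only when no edge is left. *)
Definition greedy (e0 : edge T) (first : player) : strategy T := fun h =>
  if [pick e in unclaimed h] is Some e1 then
    [arg max_(e > e1 | e \in unclaimed h)
      weight_at e (maker_edges first h) (breaker_edges first h)]
  else e0.

Lemma greedyP (e0 : edge T) (first : player) (h : seq (edge T)) (e : edge T) :
  e \in unclaimed h -> greedy e0 first h \in unclaimed h /\
  (weight_at e (maker_edges first h) (breaker_edges first h) <=
   weight_at (greedy e0 first h) (maker_edges first h) (breaker_edges first h))%N.
Proof.
move=> eU; rewrite /greedy; case: pickP => [e1 e1U|/(_ e)]; last by rewrite eU.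
by case: arg_maxnP => // e2 e2U e2max; split => //; apply: e2max.
Qed.

Lemma legal_greedy (e0 : edge T) (first : player) :
  legal_strategy first board (greedy e0 first).
Proof.
move=> h [hu hb] sz _.
have [e eU] : exists e, e \in unclaimed h.
  apply/set0Pn; apply/negP; rewrite setD_eq0 => /subset_leq_card.
  apply/negP; rewrite -ltnNge; apply: leq_ltn_trans sz.
  by rewrite cardsE; apply: card_size.
by have [] := greedyP e0 first eU; rewrite !inE => /andP[-> ->].
Qed.

(** On Breaker's turn the invariant must survive each of his replies. Positivity of the weight is
    recorded separately, since on an exhausted board there is no reply and the second clause is
    vacuous. *)
Definition maker_ahead (first : player) (h : seq (edge T)) : Prop :=
  let M := maker_edges first h in let B := breaker_edges first h in
  if maker_turn first (size h) then winning M B (unclaimed h)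
  else (0 < weight M B)%N /\
    forall y, y \in unclaimed h -> winning M (y |: B) (unclaimed h :\ y).

Lemma winning_gt0 (M B U : graph T) : (forall x, x \in U -> 0 <= beta x) ->
  winning M B U -> (0 < weight M B)%N.
Proof.
move=> b0 win; rewrite -(ltr_nat R); apply: le_lt_trans win.
by rewrite mulr_ge0 ?exprn_ge0 ?sumr_ge0.
Qed.

Hypothesis beta0 : forall x, 0 <= beta x.

Lemma maker_ahead_greedy (e0 : edge T) (first : player) (h : seq (edge T)) :
  maker_ahead first [::] -> complete_play board h ->
  follows first (greedy e0 first) h -> maker_ahead first h.
Proof.
move=> ahead0 [hu hb] hf.
suff : forall h2 h1, h = h1 ++ h2 -> maker_ahead first h1 -> maker_ahead first h.
  by move/(_ h [::]); apply.
elim=> [|e h2 IH] h1 eqh; first by rewrite eqh cats0.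
move=> ahead; apply: (IH (rcons h1 e)); first by rewrite cat_rcons.
have eh1 : e \notin h1.
  by move: hu; rewrite eqh -cat_rcons cat_uniq rcons_uniq -andbA => /andP[].
have eU : e \in unclaimed h1 by rewrite !inE eh1 -hb eqh mem_cat inE eqxx orbT.
move: ahead; rewrite /maker_ahead size_rcons maker_edges_rcons //.
rewrite breaker_edges_rcons // unclaimed_rcons.
have -> : maker_turn first (size h1).+1 = ~~ maker_turn first (size h1).
  by case: (first) => //=; rewrite negbK.
case: ifPn => [turn|_ [_]] /=; last exact.
move=> win; have es := hf _ _ _ eqh turn.
have eM : e \notin maker_edges first h1 by apply: contra eh1 => /maker_edgesS.
split=> [|y]; first by rewrite weight_maker // ltn_addr // (winning_gt0 _ win).
rewrite in_setD1 => /andP[ye yU].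
have [_] := greedyP e0 first yU; rewrite -es => mx.
exact: winning_step.
Qed.

(** The exponent [m.+1] in place of [m] pays for an opening move of Breaker. *)
Lemma maker_ahead_nil (first : player) :
  (forall i, i \in F -> A i \subset board) ->
  (forall i, i \in F -> (1 < #|A i|)%N) ->
  2 ^+ m.+1 * (\sum_(x in board) beta x) < #|F|%:R ->
  maker_ahead first [::].
Proof.
move=> Ab A2 big.
have M0 : maker_edges first [::] = set0 :> graph T by apply/setP => x; rewrite !inE.
have B0 : breaker_edges first [::] = set0 :> graph T by apply/setP => x; rewrite !inE.
have U0 : unclaimed [::] = board by rewrite /unclaimed; apply/setP => x; rewrite !inE.
have W0 : weight set0 set0 = #|F|.
  rewrite -sum1_card; apply: eq_big => [i|i _]; last by rewrite setI0 cards0.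
  by rewrite -setI_eq0 setI0 eqxx andbT.
have sb : 0 <= \sum_(x in board) beta x by rewrite sumr_ge0.
have m0 : 1 <= 2 ^+ m :> R by rewrite exprn_ege1 // ler1n.
have F0 : (0 < #|F|)%N.
  by rewrite -(ltr_nat R); apply: le_lt_trans big; rewrite mulr_ge0 ?exprn_ge0.
rewrite /maker_ahead M0 B0 U0; case: ifP => _.
  by rewrite /winning W0; apply: le_lt_trans big; rewrite exprS; nra.
(* If Breaker starts, his first edge [y] destroys at most
   [\sum_x codegree x y] sets, as each contains a second edge. *)
rewrite W0; split=> // y yb; rewrite /winning setU0.
have := weight_breaker y set0 set0; rewrite W0 setU0 => eqF.
have deg : (weight_at y set0 set0 <= \sum_(x in board :\ y) codegree x y)%N.
  rewrite /weight_at; apply: (@leq_trans (\sum_(i in F | y \in A i) 1)%N).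
    rewrite (eq_bigl (fun i => (i \in F) && (y \in A i))) => [|i].
      by apply: leq_sum => i _; rewrite setI0 cards0.
    by rewrite -setI_eq0 setI0 eqxx.
  apply: (@leq_trans (\sum_(i in F | y \in A i) \sum_(x in board :\ y) (x \in A i))%N).
    apply: leq_sum => i /andP[iF yA].
    have [x] : exists x, x \in A i :\ y.
      by apply/card_gt0P; move: (A2 i iF); rewrite (cardsD1 y) yA.
    rewrite !inE => /andP[xy xA]; rewrite (bigD1 x) /= ?xA //.
    by rewrite !inE xy (subsetP (Ab i iF)).
  rewrite exchange_big /=; apply: leq_sum => x _.
  rewrite /codegree -sum1_card big_mkcondr /=.
  rewrite [X in (_ <= X)%N]big_mkcond [X in (X <= _)%N]big_mkcond.
  by apply: leq_sum => i _; rewrite inE; case: (i \in F); case: (x \in A i); case: (y \in _).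
have : (weight_at y set0 set0)%:R <= \sum_(x in board :\ y) beta x.
  apply: le_trans (_ : (\sum_(x in board :\ y) codegree x y)%:R <= _).
    by rewrite ler_nat.
  by rewrite natr_sum; apply: ler_sum => x; rewrite !inE => /andP[xy _]; apply: codeg_beta.
move: big; rewrite eqF natrD [in X in X -> _](big_setD1 y) //=.
have sb' : 0 <= \sum_(x in board :\ y) beta x by rewrite sumr_ge0.
have := beta0 y; rewrite exprS.
set s := \sum_(_ in _) _; set w := (weight_at _ _ _)%:R; set w' := (weight _ _)%:R.
move=> by0 big ws; have : 0 <= 2 ^+ m * beta y by rewrite mulr_ge0 ?exprn_ge0.
have : s <= 2 ^+ m * s by rewrite ler_peMl.
by lra.
Qed.

(** At the end the weight is still positive, so some winning set was never touched by Breaker; as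
    the board is exhausted, all its edges are Maker's. *)
Theorem beck_criterion (first : player) (k : nat) :
  (forall i, i \in F -> A i \subset board) ->
  (forall i, i \in F -> (1 < #|A i|)%N) ->
  (forall i, i \in F -> contains_clique k (A i)) ->
  2 ^+ m.+1 * (\sum_(x in board) beta x) < #|F|%:R ->
  maker_wins_clique first board k.
Proof.
move=> Ab A2 Ak big.
have /card_gt0P[i0 i0F] : (0 < #|F|)%N.
  rewrite -(ltr_nat R); apply: le_lt_trans big.
  by rewrite mulr_ge0 ?exprn_ge0 ?sumr_ge0.
have /card_gt0P[e0 _] : (0 < #|A i0|)%N by apply: ltnW; apply: A2.
exists (greedy e0 first); split=> [|h hc hf]; first exact: legal_greedy.
have := maker_ahead_greedy (maker_ahead_nil first Ab A2 big) hc hf.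
have {hf} : (0 < weight (maker_edges first h) (breaker_edges first h))%N ->
    contains_clique k (maker_edges first h).
  rewrite lt0n sum_nat_eq0 negb_forall => /existsP[i].
  rewrite negb_imply => /andP[/andP[iF dis] _].
  have [S [Sk SA]] := Ak i iF; exists S; split=> //.
  apply: subset_trans SA _; apply/subsetP => e eA.
  move: dis; rewrite disjoint_subset => /subsetP/(_ e eA).
  rewrite inE in_setD negb_and negbK => /orP[//|].
  by rewrite inE hc.2 (subsetP (Ab i iF)).
rewrite /maker_ahead => win; case: ifP => _ => [w|[w _]]; apply: win => //.
exact: winning_gt0 w.
Qed.

End BeckCriterion.

(** * Blow-ups of cliques *)

Section Splice.
Variables (Z V : finType).

Definition splice (D : {set Z}) (phi chi : {ffun Z -> V}) : {ffun Z -> V} :=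
  [ffun z => if z \in D then chi z else phi z].

(* Exchanging the coordinates in [D] between [phi] and [chi] is an involution. *)
Lemma sum_splice (R : pzRingType) (D : {set Z}) (f : {ffun Z -> V} -> R) :
  \sum_phi \sum_chi f (splice D phi chi) = #|{ffun Z -> V}|%:R * \sum_phi f phi.
Proof.
rewrite pair_bigA /=.
pose h (u : {ffun Z -> V} * {ffun Z -> V}) := (splice D u.1 u.2, splice D u.2 u.1).
have hK : involutive h.
  case=> a b; congr (_, _); apply/ffunP => z; rewrite !ffunE /=;
    by case: ifP; rewrite ?ffunE => ->.
transitivity (\sum_u f (h u).1); first by [].
rewrite (reindex_inj (inv_inj hK)); under eq_bigr => u _ do rewrite hK.
rewrite -(pair_bigA _ (fun a _ => f a)) /= mulr_sumr; apply: eq_bigr => a _.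
by rewrite sumr_const mulr_natl.
Qed.

Lemma card_ffun_in (D : {set Z}) (Q : {set V}) :
  #|[set chi : {ffun Z -> V} | [forall z in D, chi z \in Q]]| =
  (#|Q| ^ #|D| * #|V| ^ (#|Z| - #|D|))%N.
Proof.
pose F z : pred V := [pred v | (z \in D) ==> (v \in Q)].
rewrite (@eq_card _ _ (family F)) => [|chi]; last first.
  by rewrite !inE; apply: eq_forallb => z.
rewrite card_family foldrE big_map big_enum /= (bigID (mem D)) /=.
rewrite (eq_bigr (fun=> #|Q|)) => [|z zD]; last first.
  by apply: eq_card => v; rewrite !inE zD.
rewrite prod_nat_const; congr (_ * _)%N.
rewrite (eq_bigr (fun=> #|V|)) => [|z /negbTE zD]; last first.
  by apply: eq_card => v; rewrite !inE zD.
rewrite prod_nat_const; congr (_ ^ _)%N.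
have <- := cardC D; rewrite addKn.
by apply: eq_card => z; rewrite !inE.
Qed.

End Splice.

(** * Power-mean inequality *)

Section PowerMean.
Variable R : realFieldType.

Lemma bernoulli_tangent (a b : R) (k : nat) : 0 <= a -> 0 <= b ->
  b ^+ k.+1 + k.+1%:R * b ^+ k * (a - b) <= a ^+ k.+1.
Proof.
move=> a0 b0; elim: k => [|k IH]; first by rewrite !expr1 expr0; lra.
rewrite [a ^+ _]exprS; apply: le_trans (ler_wpM2l a0 IH).
have bk : 0 <= k.+1%:R * b ^+ k by rewrite mulr_ge0 ?exprn_ge0.
(* The bound for [k] multiplied by [a] exceeds the tangent for [k.+1] by exactly this square
   term. *)
have : 0 <= k.+1%:R * b ^+ k * (a - b) ^+ 2 by rewrite mulr_ge0 ?sqr_ge0.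
rewrite -[k.+2%:R]natr1 !exprS; set x := b ^+ k; set y := k.+1%:R.
by move=> h; lra.
Qed.

(** Sum the tangent bounds at the mean [b]: the linear terms cancel. *)
Lemma power_mean (I : finType) (x : I -> R) (k : nat) : (forall i, 0 <= x i) ->
  ((\sum_i x i) / #|I|%:R) ^+ k.+1 <= (\sum_i x i ^+ k.+1) / #|I|%:R.
Proof.
move=> x0; have [I0|I0] := posnP #|I|.
  by rewrite I0 invr0 !mulr0 expr0n.
have N0 : 0 < #|I|%:R :> R by rewrite ltr0n.
set b := (\sum_i x i) / _.
have b0 : 0 <= b by rewrite divr_ge0 ?sumr_ge0.
rewrite ler_pdivlMr //.
apply: le_trans (ler_sum _ (fun i _ => bernoulli_tangent k (x0 i) b0)).
have bN : b * #|I|%:R = \sum_i x i by rewrite /b divfK ?gt_eqF.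
rewrite big_split /= -mulr_sumr sumrB !sumr_const -[b *+ _]mulr_natr bN subrr.
by rewrite mulr0 addr0 mulr_natr.
Qed.

End PowerMean.

Section BlowUp.
Variables (R : realFieldType) (V : finType) (adj : rel V) (r t : nat).
Variables (a0 : 'I_t) (eps : R).
Hypothesis adj_sym : symmetric adj.
Hypothesis V0 : (0 < #|V|)%N.
Hypothesis eps0 : 0 <= eps.
Hypothesis common : forall S : {set V}, (#|S| < r)%N ->
  eps * #|V|%:R <= #|[set v | [forall u in S, adj v u]]|%:R.

Local Notation Z := ('I_r * 'I_t)%type.
Local Notation FF := {ffun Z -> V}.
Implicit Types (phi chi : FF) (P : pred FF).

Definition density P : R := #|[set phi | P phi]|%:R / #|{: FF}|%:R.

Lemma FF_gt0 : 0 < #|{: FF}|%:R :> R.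
Proof. by rewrite ltr0n card_ffun expn_gt0 V0. Qed.

Lemma density_ge0 P : 0 <= density P.
Proof. by rewrite divr_ge0. Qed.

Lemma card_pred P : #|[set phi | P phi]|%:R = \sum_phi (P phi)%:R :> R.
Proof.
rewrite -sum1_card natr_sum big_mkcond /=; apply: eq_bigr => phi _.
by rewrite inE; case: (P phi).
Qed.

(** Resampling the coordinates in [D] does not change the distribution of a uniform map, so a
    density is the average of its conditional densities given the coordinates outside [D]. *)
Lemma density_splice (D : {set Z}) P : density P =
  (\sum_phi density (fun chi => P (splice D phi chi))) / #|{: FF}|%:R.
Proof.
rewrite /density -mulr_suml; under eq_bigr => phi _ do rewrite card_pred.
rewrite (sum_splice D (fun phi => (P phi)%:R)) -card_pred.
by rewrite [X in _ = X / _ / _]mulrC mulfK // gt_eqF ?FF_gt0.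
Qed.

Lemma density_le P P' : (forall phi, P phi -> P' phi) -> density P <= density P'.
Proof.
move=> PP'; rewrite ler_pM2r ?invr_gt0 ?FF_gt0 // ler_nat subset_leq_card //.
by apply/subsetP => phi; rewrite !inE; apply: PP'.
Qed.

Lemma density_in (D : {set Z}) (Q : {set V}) :
  density (fun chi => [forall z in D, chi z \in Q]) = (#|Q|%:R / #|V|%:R) ^+ #|D|.
Proof.
rewrite /density card_ffun_in card_ffun !natrM !natrX.
have V1 : #|V|%:R != 0 :> R by rewrite pnatr_eq0 -lt0n.
rewrite -[in X in _ / X](subnKC (max_card (mem D))) exprD expr_div_n.
by field; rewrite !expf_neq0.
Qed.

Definition partial_clique (k : nat) phi :=
  [forall i : 'I_r, forall j : 'I_r, (i < j < k)%N ==> adj (phi (i, a0)) (phi (j, a0))].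

(** The representatives are chosen one after the other: fewer than [r] are fixed, so by [common] a
    proportion of at least [eps] of the vertices extends the clique. *)
Lemma density_partial_clique (k : nat) : (k <= r)%N -> eps ^+ k <= density (partial_clique k).
Proof.
elim: k => [_|k IH kr].
  rewrite expr0 /density (_ : [set _ | _] = setT).
    by rewrite cardsT divff // gt_eqF ?FF_gt0.
  apply/setP => phi; rewrite !inE; apply/forallP => i; apply/forallP => j.
  by rewrite ltn0 andbF.
have := IH (ltnW kr); pose z : Z := (Ordinal kr, a0).
rewrite (density_splice [set z] (partial_clique k.+1)) exprS => {}IH.
apply: le_trans (ler_wpM2l eps0 IH) _.
rewrite /density mulrA ler_pM2r ?invr_gt0 ?FF_gt0 // card_pred mulr_sumr.
apply: ler_sum => phi _; case: (boolP (partial_clique k phi)) => Pphi; last first.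
  by rewrite mulr0 density_ge0.
rewrite mulr1; pose S := [set phi (i, a0) | i : 'I_r in [set i : 'I_r | (i < k)%N]].
have Sr : (#|S| < r)%N.
  apply: leq_ltn_trans (leq_imset_card _ _) _; apply: (leq_ltn_trans _ kr).
  rewrite -[X in (_ <= X)%N]card_ord.
  apply: leq_trans (leq_imset_card (widen_ord (ltnW kr)) predT).
  apply/subset_leq_card/subsetP => i; rewrite inE => ik.
  by apply/imsetP; exists (Ordinal ik) => //; apply: val_inj.
pose Q := [set v | [forall u in S, adj v u]].
apply: le_trans (_ : #|Q|%:R / #|V|%:R <= _).
  by rewrite ler_pdivlMr ?ltr0n //; apply: common.
rewrite -[X in X <= _]expr1 -(cards1 z) -density_in; apply: density_le => chi /forall_inP Hchi.
have zQ : chi z \in Q by apply: Hchi; rewrite inE.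
apply/forallP => i; apply/forallP => j; apply/implyP => /andP[ij].
rewrite ltnS leq_eqVlt !ffunE !inE !xpair_eqE !eqxx !andbT -!val_eqE /=.
case: eqVneq => [jk _|jk /= jk'].
  move: ij; rewrite jk => ij.
  have {jk} <- : Ordinal kr = j by apply/val_inj.
  rewrite (ltn_eqF ij) adj_sym.
  move: zQ; rewrite inE => /forall_inP; apply; apply/imsetP.
  by exists i => //; rewrite inE.
rewrite (ltn_eqF (ltn_trans ij jk')).
by move/forallP/(_ i)/forallP/(_ j): Pphi; rewrite ij jk'.
Qed.

(* At stage [k] the rows before [k] are blown up to their [t] columns; the other
   rows are still represented by their column [a0]. *)
Definition active (k : nat) (z : Z) := (z.1 < k)%N || (z.2 == a0).

Definition partial_blow_up (k : nat) phi :=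
  [forall y : Z, forall z : Z,
    [&& y.1 != z.1, active k y & active k z] ==> adj (phi y) (phi z)].

Lemma partial_blow_up0 phi : partial_clique r phi -> partial_blow_up 0 phi.
Proof.
move=> /forallP H; apply/forallP => -[i a]; apply/forallP => -[j b].
apply/implyP; rewrite /active /= => /and3P[ij /eqP -> /eqP ->].
have := forallP (H i) j; have := forallP (H j) i; rewrite !ltn_ord !andbT.
by move: ij; rewrite -val_eqE neq_ltn adj_sym => /orP[] ->.
Qed.

(** Given all rows except [k], the [t] vertices of row [k] are independent and each is admissible
    with the same probability. So one vertex succeeds with probability at most [q phi], all [t] with
    probability at least [q phi ^+ t], and the power-mean inequality compares the averages over
    [phi]. *)
Lemma density_blow_up_step (k : nat) : (k < r)%N ->
  density (partial_blow_up k) ^+ t <= density (partial_blow_up k.+1).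
Proof.
move=> kr; pose i0 := Ordinal kr; pose D := [set z : Z | z.1 == i0].
have cardD : #|D| = t.
  have inj : injective (fun a : 'I_t => (i0, a)) by move=> a b [].
  rewrite -[RHS]card_ord -cardsT -(card_imset _ inj).
  apply: eq_card => -[i a]; rewrite inE /=; apply/eqP/imsetP => [->|[b _ [-> _]]] //.
  by exists a.
have t0 : (0 < t)%N by apply: leq_ltn_trans (ltn_ord a0).
(* [Q phi] are the admissible images of a vertex in row [k], and [C phi] is the adjacency condition
   among the other rows. Neither depends on the values of [phi] on row [k]. *)
pose Q phi := [set v | [forall z : Z, (z.1 != i0) && active k z ==> adj v (phi z)]].
pose C phi := [forall y : Z, forall z : Z,
  [&& y.1 != i0, z.1 != i0, y.1 != z.1, active k y & active k z] ==> adj (phi y) (phi z)].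
pose q phi : R := (C phi)%:R * (#|Q phi|%:R / #|V|%:R).
have act z : z.1 != i0 -> active k.+1 z = active k z.
  by rewrite /active ltnS leq_eqVlt -val_eqE /= => /negbTE ->.
have q0 phi : 0 <= q phi by rewrite mulr_ge0 ?divr_ge0.
have ub phi : density (fun chi => partial_blow_up k (splice D phi chi)) <= q phi.
  rewrite -[q phi]mulr1 /q; case: (boolP (C phi)) => Cphi.
    rewrite mul1r mulr1 -[X in _ <= X]expr1 -(cards1 (i0, a0)) -density_in.
    apply: density_le => chi /forallP H; apply/forall_inP => z /set1P ->.
    rewrite inE; apply/forallP => z'; apply/implyP => /andP[z'i z'a].
    have := forallP (H (i0, a0)) z'.
    by rewrite /= eq_sym z'i z'a /active eqxx orbT /= !ffunE !inE eqxx (negbTE z'i).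
  rewrite !mul0r /density (_ : [set _ | _] = set0) ?cards0 ?mul0r //.
  apply/setP => chi; rewrite !inE; apply: contraNF Cphi => /forallP H.
  apply/forallP => y; apply/forallP => z; apply/implyP => /and5P[yi zi yz ya za].
  have := forallP (H y) z.
  by rewrite yz ya za !ffunE !inE (negbTE yi) (negbTE zi).
have lb phi : q phi ^+ t <= density (fun chi => partial_blow_up k.+1 (splice D phi chi)).
  rewrite /q; case: (boolP (C phi)) => Cphi; last by rewrite mul0r expr0n gtn_eqF // density_ge0.
  rewrite mul1r -[X in _ ^+ X]cardD -density_in; apply: density_le => chi /forall_inP H.
  apply/forallP => y; apply/forallP => z; apply/implyP => /and3P[yz ya za].
  rewrite !ffunE !inE; case: (eqVneq y.1 i0) => yi; case: (eqVneq z.1 i0) => zi.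
  - by move: yz; rewrite yi zi eqxx.
  - have /H : y \in D by rewrite inE yi.
    by rewrite inE => /forallP/(_ z); rewrite zi -act ?za.
  - have /H : z \in D by rewrite inE zi.
    by rewrite inE => /forallP/(_ y); rewrite yi -act ?ya // adj_sym.
  by move/forallP/(_ y)/forallP/(_ z): Cphi; rewrite yi zi yz -!act ?ya ?za.
rewrite (density_splice D (partial_blow_up k)) (density_splice D (partial_blow_up k.+1)).
apply: le_trans (_ : ((\sum_phi q phi) / #|{: FF}|%:R) ^+ t <= _).
  rewrite lerXn2r ?nnegrE ?divr_ge0 ?sumr_ge0 // => [phi _|].
    exact: density_ge0.
  by rewrite ler_pM2r ?invr_gt0 ?FF_gt0 //; apply: ler_sum.
have := power_mean t.-1 q0; rewrite prednK // => /le_trans; apply.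
by rewrite ler_pM2r ?invr_gt0 ?FF_gt0 //; apply: ler_sum.
Qed.

Lemma density_blow_up : (eps ^+ r) ^+ (t ^ r) <= density (partial_blow_up r).
Proof.
suff H k : (k <= r)%N -> (eps ^+ r) ^+ (t ^ k) <= density (partial_blow_up k) by apply: H.
elim: k => [_|k IH kr].
  rewrite expn0 expr1; apply: le_trans (density_partial_clique (leqnn r)) _.
  exact: density_le partial_blow_up0.
apply: le_trans (density_blow_up_step kr).
rewrite expnSr exprM lerXn2r ?nnegrE ?exprn_ge0 ?density_ge0 //.
exact: IH (ltnW kr).
Qed.

Lemma density_eq (y z : Z) : y != z ->
  density (fun phi => phi y == phi z) = #|V|%:R^-1.
Proof.
move=> yz; rewrite (density_splice [set y]).
rewrite (eq_bigr (fun=> #|V|%:R^-1)) => [|phi _].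
  by rewrite sumr_const -[_ *+ _]mulr_natr mulfK // gt_eqF ?FF_gt0.
transitivity (density (fun chi => [forall x in [set y], chi x \in [set phi z]])).
  congr (#|pred_of_set _|%:R / _); apply/setP => chi; rewrite !inE !ffunE !inE eqxx.
  rewrite [z == y]eq_sym (negbTE yz); apply/eqP/forall_inP => [<- x /set1P ->|/(_ y)].
    by rewrite inE.
  by rewrite !inE eqxx => /(_ isT)/eqP.
by rewrite density_in !cards1 expr1 mul1r.
Qed.

Definition embedding phi := injectiveb phi &&
  [forall y : Z, forall z : Z, (y.1 != z.1) ==> adj (phi y) (phi z)].

(** A blow-up that is not injective identifies two of its [r * t] vertices, which has probability
    [#|V|%:R^-1] for each pair. The union bound is taken over all ordered pairs, with the diagonal
    included for a simpler count. *)
Lemma density_embedding :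
  (eps ^+ r) ^+ (t ^ r) - (r * t)%:R ^+ 2 / #|V|%:R <= density embedding.
Proof.
rewrite lerBlDr; apply: le_trans density_blow_up _.
rewrite -[X in _ + X](_ : \sum_(u : Z * Z) #|V|%:R^-1 = _); last first.
  by rewrite sumr_const !card_prod !card_ord -[_ *+ _]mulr_natl natrM expr2.
apply: le_trans (_ : density embedding + \sum_(u : Z * Z | u.1 != u.2)
   density (fun phi => phi u.1 == phi u.2) <= _); last first.
  rewrite lerD2l [X in _ <= X](bigID (fun u => u.1 != u.2)) /= -[X in X <= _]addr0.
  apply: lerD; last by rewrite sumr_ge0 // => u _; rewrite invr_ge0.
  by apply: ler_sum => u /density_eq ->.
rewrite /density -mulr_suml -mulrDl ler_pM2r ?invr_gt0 ?FF_gt0 //.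
under eq_bigr => u _ do rewrite card_pred.
rewrite exchange_big !card_pred -big_split /=; apply: ler_sum => phi _.
case: (boolP (partial_blow_up r phi)) => bu; last first.
  by rewrite addr_ge0 ?ler0n ?sumr_ge0.
case: (boolP (injectiveb phi)) => inj.
  rewrite /embedding inj (_ : [forall y, _]) ?lerDl ?sumr_ge0 //.
  apply/forallP => y; apply/forallP => z.
  by move/forallP/(_ y)/forallP/(_ z): bu; rewrite /active !ltn_ord /= !andbT.
have /injectivePn [y [z yz eqyz]] := inj.
rewrite (bigD1 (y, z)) //= eqyz eqxx addrA addrAC lerDr addr_ge0 ?ler0n //.
by rewrite sumr_ge0.
Qed.

End BlowUp.

(** * Inner edges of a copy *)

Section Adjacency.
Variables (T : finType) (G : graph T).

Definition adjacency : rel T := fun u v => [exists e in G, val e == [set u; v]].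

Lemma adjacency_sym : symmetric adjacency.
Proof. by move=> u v; apply: eq_existsb => e; rewrite setUC. Qed.

Lemma degree_adjacency (v : T) : (degree G v <= #|[set u | adjacency u v]|)%N.
Proof.
rewrite /degree -(card_imset _ val_inj).
apply: leq_trans (leq_imset_card (fun u => [set u; v]) [set u | adjacency u v]).
apply/subset_leq_card/subsetP => D /imsetP[e]; rewrite inE => /andP[eG ve] ->.
have /cards2P[a [b [ab eab]]] : #|val e| == 2 := valP e.
have : exists2 u, val e = [set u; v] & u != v.
  move: ve; rewrite eab !inE => /orP[] /eqP ->; last by exists a.
  by exists b; rewrite 1?setUC 1?eq_sym.
case=> u eu uv; rewrite eu; apply: (imset_f (fun u => [set u; v])); rewrite inE.
by apply/existsP; exists e; rewrite eG eu eqxx.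
Qed.

Lemma min_degree_le (v : T) : (min_degree G <= degree G v)%N.
Proof.
rewrite /min_degree; have := mem_index_enum v.
elim: (index_enum T) => // w s IH; rewrite big_cons inE => /orP[/eqP <-|/IH].
  exact: geq_minl.
by apply: leq_trans; apply: geq_minr.
Qed.

(** Each vertex of [S] has at most [(1 - a) * #|T|%:R] non-neighbours, itself included, and a vertex
    outside the set is a non-neighbour of some member of [S]. *)
Lemma common_neighbours (R : realFieldType) (a : R) (S : {set T}) :
  a * #|T|%:R <= (min_degree G)%:R ->
  (1 - #|S|%:R * (1 - a)) * #|T|%:R <= #|[set v | [forall u in S, adjacency v u]]|%:R.
Proof.
move=> ha; set X := [set v | _].
have cX : (#|~: X| <= \sum_(u in S) #|[set v | ~~ adjacency v u]|)%N.
  apply: (@leq_trans #|\bigcup_(u in S) [set v | ~~ adjacency v u]|).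
    apply/subset_leq_card/subsetP => v; rewrite !inE negb_forall => /existsP[u].
    by rewrite negb_imply => /andP[uS vu]; apply/bigcupP; exists u; rewrite ?inE.
  elim/big_ind2: _ => [|m1 X1 m2 X2 h1 h2|//]; first by rewrite cards0.
  by rewrite cardsU; apply: leq_trans (leq_subr _ _) (leq_add h1 h2).
have nb u : #|[set v | ~~ adjacency v u]|%:R <= (1 - a) * #|T|%:R.
  have -> : [set v | ~~ adjacency v u] = ~: [set v | adjacency v u].
    by apply/setP => v; rewrite !inE.
  have := cardsC [set v | adjacency v u] => /(congr1 (fun k => k%:R : R)).
  rewrite natrD; have := leq_trans (min_degree_le u) (degree_adjacency u).
  by rewrite -(ler_nat R); lra.
have : #|~: X|%:R <= #|S|%:R * ((1 - a) * #|T|%:R).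
  apply: le_trans (_ : (\sum_(u in S) #|[set v | ~~ adjacency v u]|)%:R <= _).
    by rewrite ler_nat.
  rewrite natr_sum; apply: le_trans (ler_sum _ (fun u _ => nb u)) _.
  by rewrite sumr_const mulr_natl.
have := cardsC X => /(congr1 (fun k => k%:R : R)); rewrite natrD.
by lra.
Qed.

End Adjacency.

Section InnerEdges.
Variables (T : finType) (r t : nat).
Local Notation Z := ('I_r * 'I_t)%type.
Local Notation FF := {ffun Z -> T}.
Implicit Types (phi psi : FF) (S : {set Z}).

(* The part of a vertex of the copy is its row, so [inner phi] are the edges of
   the copy [phi] that are to come from the random graph. *)
Definition single_row S := [forall y in S, forall z in S, y.1 == z.1].

Definition pairs S : {set {set Z}} :=
  [set D : {set Z} | [&& D \subset S, #|D| == 2 & single_row D]].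

Definition inner phi : graph T :=
  [set e | [exists D : {set Z} in pairs setT, val e == phi @: D]].

(** Common vertices are recorded by their positions in [psi], which leaves at most [2 ^ (r * t)]
    possible overlaps whatever the size of [T]. *)
Definition overlap phi psi : {set Z} := psi @^-1: (phi @: setT).

Lemma card_inner phi : injective phi -> #|inner phi| = #|pairs setT|.
Proof.
move=> inj; rewrite -(card_imset _ val_inj) -(card_imset _ (imset_inj inj)).
apply: eq_card => X; apply/imsetP/imsetP => [[e]|[D DP ->]].
  by rewrite inE => /existsP[D /andP[DP /eqP eD]] ->; exists D.
have D2 : #|phi @: D| == 2.
  by move: DP; rewrite inE card_imset // => /and3P[].
exists (exist _ (phi @: D) D2) => //.
by rewrite inE; apply/existsP; exists D; rewrite DP eqxx.
Qed.

(** A common inner edge comes from a pair of [overlap phi psi] inside one row of [psi]. Equality may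
    fail, since such a pair may lie in two rows of [phi]. *)
Lemma card_innerI phi psi :
  (#|inner psi :&: inner phi| <= #|pairs (overlap phi psi)|)%N.
Proof.
rewrite -(card_imset _ val_inj).
apply: leq_trans (leq_imset_card (fun D : {set Z} => psi @: D) _).
apply/subset_leq_card/subsetP => X /imsetP[e]; rewrite !inE.
case/andP=> /existsP[D /andP[DP /eqP eD]] /existsP[D' /andP[_ /eqP eD']] ->.
apply/imsetP; exists D => //; move: DP; rewrite !inE => /and3P[_ -> ->].
rewrite !andbT; apply/subsetP => z zD; rewrite inE.
have : psi z \in phi @: D' by rewrite -eD' eD imset_f.
by apply/subsetP; apply: imsetS; apply: subsetT.
Qed.

Lemma card_innerD phi psi : injective psi ->
  (#|pairs setT| - #|pairs (overlap phi psi)| <= #|inner psi :\: inner phi|)%N.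
Proof. by move=> inj; rewrite cardsD card_inner // leq_sub2l // card_innerI. Qed.

Definition row_size S (i : 'I_r) := #|[set z in S | z.1 == i]|.

Lemma card_rows S : #|S| = (\sum_(i < r) row_size S i)%N.
Proof.
rewrite -sum1_card (partition_big (fun z : Z => z.1) predT) //=.
apply: eq_bigr => i _; rewrite /row_size -sum1_card.
by apply: eq_bigl => z; rewrite inE.
Qed.

Lemma row_size_le S i : (row_size S i <= t)%N.
Proof.
rewrite -[X in (_ <= X)%N]card_ord.
apply: leq_trans (leq_imset_card (fun a : 'I_t => (i, a)) predT).
apply/subset_leq_card/subsetP => -[j a]; rewrite inE /= => /andP[_ /eqP ->].
by apply/imsetP; exists a.
Qed.

Lemma card_pairs S : (#|pairs S| <= \sum_(i < r) 'C(row_size S i, 2))%N.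
Proof.
under eq_bigr => i _ do rewrite -cards_draws.
pose row_pairs i := [set D : {set Z} | D \subset [set z in S | z.1 == i] & #|D| == 2].
apply: (@leq_trans #|\bigcup_(i < r) row_pairs i|).
  apply/subset_leq_card/subsetP => D; rewrite inE => /and3P[DS D2 /forall_inP Dr].
  have /card_gt0P[y yD] : (0 < #|D|)%N by rewrite (eqP D2).
  apply/bigcupP; exists y.1 => //; rewrite inE D2 andbT.
  apply/subsetP => z zD; rewrite inE (subsetP DS) // eq_sym.
  by move/forall_inP: (Dr y yD); apply.
elim/big_ind2: _ => [|m1 X1 m2 X2 h1 h2|//]; first by rewrite cards0.
by rewrite cardsU; apply: leq_trans (leq_subr _ _) (leq_add h1 h2).
Qed.

Lemma single_row_size S y : y \in S -> single_row S -> row_size S y.1 = #|S|.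
Proof.
move=> yS /forall_inP/(_ y yS)/forall_inP Sr; apply: eq_card => z; rewrite inE.
by case: (boolP (z \in S)) => //= zS; rewrite eq_sym Sr.
Qed.

End InnerEdges.

(** * Expected numbers of extensions *)

Section RowWeights.
Variables (R : realFieldType) (r t : nat) (n p l : R).
Hypothesis p01 : 0 < p <= 1.
Hypothesis l1 : 1 <= l.
Hypothesis n0 : 0 <= n.
Hypothesis t2 : (2 <= t)%N.
Hypothesis dense : l ^+ 2 <= n ^+ 2 * p ^+ t.+1.
Local Notation Z := ('I_r * 'I_t)%type.
Implicit Types S : {set Z}.

(* The order of magnitude of the expected number of copies of K_s; likewise
   [set_weight S] for the part of a copy spanned by [S]. *)
Definition row_weight (s : nat) : R := n ^+ s * p ^+ 'C(s, 2).

Definition set_weight S : R := n ^+ #|S| * p ^+ #|pairs S|.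

Let p0 : 0 < p. Proof. by case/andP: p01. Qed.
Let p1 : p <= 1. Proof. by case/andP: p01. Qed.
Let l0 : 0 <= l. Proof. exact: le_trans l1. Qed.

Lemma exp_dense (k : nat) : (k <= t.+1)%N -> l ^+ 2 <= n ^+ 2 * p ^+ k.
Proof.
move=> kt; apply: le_trans dense _; apply: ler_wpM2l; first exact: exprn_ge0.
by apply: ler_wiXn2l => //; apply: ltW.
Qed.

Lemma n_ge : l <= n.
Proof.
rewrite -(@ler_pXn2r _ 2) ?nnegrE //; apply: le_trans (exp_dense (leq0n _)) _.
by rewrite expr0 mulr1.
Qed.

Lemma np_ge : l <= n * p.
Proof.
have np0 : 0 <= n * p by rewrite mulr_ge0 // ltW.
rewrite -(@ler_pXn2r _ 2) ?nnegrE //; rewrite exprMn.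
by apply: exp_dense; apply: leq_trans t2 _.
Qed.

(* [row_weight s = n^2 p (n p^((s+1)/2))^(s-2)], squared because of the
   half-integral exponent; the last base is at least [l] for [s <= t]. *)
Lemma row_weightSS (j : nat) :
  row_weight j.+2 ^+ 2 = (n ^+ 2 * p) ^+ 2 * (n ^+ 2 * p ^+ j.+3) ^+ j.
Proof.
have bin : ('C(j.+2, 2) * 2 = 2 + j.+3 * j)%N.
  elim: j => // j IH; rewrite binS bin1 mulnDl IH; lia.
rewrite /row_weight [LHS]exprMn [(n ^+ 2 * p) ^+ 2]exprMn [(n ^+ 2 * p ^+ j.+3) ^+ j]exprMn.
rewrite -[(p ^+ 'C(_, _)) ^+ 2]exprM bin exprD [p ^+ (_ * _)]exprM.
have -> : (n ^+ j.+2) ^+ 2 = (n ^+ 2) ^+ 2 * (n ^+ 2) ^+ j.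
  by rewrite -!exprM -exprD; congr (_ ^+ _); lia.
by rewrite mulrACA.
Qed.

(** By [row_weightSS] with [s = j + 2], the square has [j] factors that are at least [l ^+ 2] by
    [dense], and [k <= j]. *)
Lemma row_weight_ge (s k : nat) : (k.+2 <= s <= t)%N -> (k <= 1)%N ->
  n ^+ 2 * p * l ^+ k <= row_weight s.
Proof.
move=> /andP[ks st] k1; case: s ks st => [|[|j]] // kj jt.
have np0 : 0 <= n ^+ 2 * p by rewrite mulr_ge0 ?exprn_ge0 // ltW.
have w0 : 0 <= row_weight j.+2 by rewrite mulr_ge0 ?exprn_ge0 // ltW.
have lk0 : 0 <= n ^+ 2 * p * l ^+ k := mulr_ge0 np0 (exprn_ge0 k l0).
rewrite -(@ler_pXn2r _ 2) ?nnegrE //.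
rewrite row_weightSS exprMn; apply: ler_wpM2l; first exact: exprn_ge0.
have h : l ^+ 2 <= n ^+ 2 * p ^+ j.+3 by apply: exp_dense; lia.
have h1 : 1 <= l ^+ 2 by rewrite exprn_ege1.
apply: le_trans (_ : (l ^+ 2) ^+ j <= _).
  by rewrite [X in X <= _]exprAC; apply: ler_weXn2l => //; lia.
have h0 : 0 <= l ^+ 2 by apply: le_trans h1.
by apply: lerXn2r (h); rewrite nnegrE //; apply: le_trans h.
Qed.

Lemma row_weight_ge_n (s : nat) : (0 < s <= t)%N -> n <= row_weight s.
Proof.
case/andP; case: s => [|[|s]] // _ st; first by rewrite /row_weight expr1 expr0 mulr1.
apply: le_trans (_ : n ^+ 2 * p * l ^+ 0 <= _); last exact: row_weight_ge.
rewrite expr0 mulr1 expr2 -mulrA ler_peMr //.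
exact: le_trans np_ge.
Qed.

Lemma row_weight_ge1 (s : nat) : (s <= t)%N -> 1 <= row_weight s.
Proof.
case: s => [|s] st; first by rewrite /row_weight !expr0 mulr1.
by apply: le_trans (row_weight_ge_n _) => //; apply: le_trans n_ge.
Qed.

Lemma set_weight_ge S : \prod_(i < r) row_weight (row_size S i) <= set_weight S.
Proof.
rewrite big_split /= !prodrXr -card_rows ler_wpM2l ?exprn_ge0 //.
by apply: ler_wiXn2l; rewrite ?card_pairs // ltW.
Qed.

Lemma prod_ge1 (P : pred 'I_r) S : 1 <= \prod_(i < r | P i) row_weight (row_size S i).
Proof.
elim/big_ind: _ => // [x y x1 y1|i _]; first exact: mulr_ege1.
exact/row_weight_ge1/row_size_le.
Qed.

Lemma set_weight_row S (i : 'I_r) : row_weight (row_size S i) <= set_weight S.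
Proof.
apply: le_trans (set_weight_ge S); rewrite (bigD1 i) //= ler_peMr ?prod_ge1 //.
exact/(le_trans ler01)/row_weight_ge1/row_size_le.
Qed.

Lemma set_weight_rows S (i j : 'I_r) : i != j ->
  row_weight (row_size S i) * row_weight (row_size S j) <= set_weight S.
Proof.
move=> ij; apply: le_trans (set_weight_ge S).
rewrite (bigD1 i) //= (bigD1 j) 1?eq_sym //= mulrA ler_peMr ?prod_ge1 //.
by apply: mulr_ge0; apply/(le_trans ler01)/row_weight_ge1/row_size_le.
Qed.

(** For the variance: only overlaps containing a pair inside a row can make two copies dependent. *)
Lemma set_weight_pair S : pairs S != set0 -> n ^+ 2 * p <= set_weight S.
Proof.
case/set0Pn => D; rewrite inE => /and3P[DS /eqP D2 Dr].
have /card_gt0P[y yD] : (0 < #|D|)%N by rewrite D2.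
apply: le_trans (set_weight_row S y.1).
have {1}-> : n ^+ 2 * p = n ^+ 2 * p * l ^+ 0 by rewrite mulr1.
apply: row_weight_ge => //; rewrite row_size_le andbT.
apply: (@leq_trans #|D|); first by rewrite D2.
rewrite -(single_row_size yD Dr); apply/subset_leq_card/subsetP => z.
by rewrite !inE => /andP[/(subsetP DS) -> ->].
Qed.

Lemma set_weight_single_row S : (2 < #|S|)%N -> single_row S ->
  n ^+ 2 * p * l <= set_weight S.
Proof.
move=> S3 Sr; have /card_gt0P[y yS] : (0 < #|S|)%N by apply: leq_trans S3.
apply: le_trans (set_weight_row S y.1); rewrite -[in X in X <= _](expr1 l).
by apply: row_weight_ge => //; rewrite row_size_le andbT single_row_size.
Qed.

(** Either a row with at least two vertices meets [S] besides another nonempty row, giving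
    [n ^+ 2 * p] times [n] with [n * p >= l]; or all rows have at most one vertex, so no power of
    [p] arises and [n ^+ 3] suffices. *)
Lemma set_weight_not_single_row S : (2 < #|S|)%N -> ~~ single_row S ->
  n ^+ 2 * l <= set_weight S.
Proof.
move=> S3 Sr.
have size_gt0 z : z \in S -> (0 < row_size S z.1)%N.
  by move=> zS; apply/card_gt0P; exists z; rewrite inE zS eqxx.
case: (boolP [exists i, 2 <= row_size S i]%N) => [/existsP[i i2]|/existsPn small].
  have [j jS ij] : exists2 j, (0 < row_size S j)%N & i != j.
    move: Sr; rewrite negb_forall_in => /exists_inP[y yS].
    rewrite negb_forall_in => /exists_inP[z zS yz].
    have [iy|iy] := eqVneq i y.1; last by exists y.1; rewrite ?size_gt0.
    by exists z.1; rewrite ?size_gt0 // iy.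
  apply: le_trans (set_weight_rows S ij).
  have hi := @row_weight_ge (row_size S i) 0; rewrite i2 row_size_le in hi.
  have hj := @row_weight_ge_n (row_size S j); rewrite jS row_size_le in hj.
  have {}hi : n ^+ 2 * p <= row_weight (row_size S i) by rewrite -[X in X <= _]mulr1; apply: hi.
  have np0 : 0 <= n ^+ 2 * p by rewrite mulr_ge0 ?exprn_ge0 // ltW.
  apply: le_trans (ler_pM np0 n0 hi (hj isT)).
  rewrite -[n ^+ 2 * p * n]mulrA [p * n]mulrC.
  by apply: ler_wpM2l; [exact: exprn_ge0 | exact: np_ge].
apply: le_trans (set_weight_ge S).
rewrite (eq_bigr (fun i => n ^+ row_size S i)) => [|i _]; last first.
  rewrite /row_weight bin_small ?expr0 ?mulr1 //.
  by rewrite ltnNge small.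
rewrite prodrXr -card_rows.
apply: le_trans (_ : n ^+ 3 <= _); last first.
  by apply: ler_weXn2l => //; apply: le_trans n_ge.
by rewrite [n ^+ 3]exprSr ler_wpM2l ?exprn_ge0 // n_ge.
Qed.

End RowWeights.

(** * Expectations in the binomial random graph *)

Section Expectation.
Variables (R : realFieldType) (T : finType) (p : R).
Hypothesis p01 : 0 < p <= 1.
Implicit Types (f g : graph T -> R) (H : graph T).

Definition gnp_weight H : R := \prod_(e : edge T) (if e \in H then p else 1 - p).

Definition expect f : R := \sum_H gnp_weight H * f H.

Lemma gnp_weight_ge0 H : 0 <= gnp_weight H.
Proof.
case/andP: p01 => p0 p1; apply: prodr_ge0 => e _; case: ifP => _; first exact: ltW.
by rewrite subr_ge0.
Qed.

Lemma expect_subset (I : graph T) : expect (fun H => (I \subset H)%:R) = p ^+ #|I|.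
Proof.
rewrite /expect.
(* Distributing this product over the choices of [H] gives the factor 0 to each [H] that misses an
   edge of [I]. *)
transitivity (\prod_(e : edge T) (p + (if e \in I then 0 else 1 - p))).
  rewrite bigA_distr; apply: eq_bigr => H _; rewrite /gnp_weight.
  case: (boolP (I \subset H)) => [IH|/subsetPn[e eI eH]].
    rewrite mulr1; apply: eq_bigr => e _; case: (boolP (e \in I)) => // eI.
    by rewrite (subsetP IH).
  by rewrite mulr0 (bigD1 e) //= (negbTE eH) eI mul0r.
rewrite (bigID (mem I)) /= [X in _ * X]big1 ?mulr1 => [|e /negbTE ->]; last first.
  by rewrite addrC subrK.
rewrite -prodr_const; apply: eq_bigr => e ->.
by rewrite addr0.
Qed.

Lemma expectD f g : expect (fun H => f H + g H) = expect f + expect g.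
Proof. by rewrite /expect -big_split; apply: eq_bigr => H _; rewrite mulrDr. Qed.

Lemma expectZ (a : R) f : expect (fun H => a * f H) = a * expect f.
Proof. by rewrite /expect mulr_sumr; apply: eq_bigr => H _; rewrite mulrCA. Qed.

Lemma expect_sum (I : finType) (P : pred I) (F : I -> graph T -> R) :
  expect (fun H => \sum_(i | P i) F i H) = \sum_(i | P i) expect (F i).
Proof.
rewrite /expect exchange_big; apply: eq_bigr => H _.
by rewrite mulr_sumr.
Qed.

Lemma expect1 : expect (fun=> 1) = 1.
Proof.
rewrite -[RHS](expr0 p) -(cards0 (edge T)) -expect_subset.
by apply: eq_bigr => H _; rewrite sub0set.
Qed.

Lemma eq_expect f g : f =1 g -> expect f = expect g.
Proof. by move=> fg; apply: eq_bigr => H _; rewrite fg. Qed.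

Lemma expect_card : expect (fun H => #|H|%:R) = #|{: edge T}|%:R * p.
Proof.
rewrite (@eq_expect _ (fun H => \sum_(e : edge T) ([set e] \subset H)%:R)) => [|H].
  rewrite expect_sum; under eq_bigr => e _ do rewrite expect_subset cards1 expr1.
  by rewrite sumr_const mulr_natl.
rewrite -sum1_card natr_sum big_mkcond; apply: eq_bigr => e _.
by rewrite sub1set; case: (e \in H).
Qed.

End Expectation.

Section Extensions.
Variables (R : realFieldType) (T : finType) (r t : nat) (p : R).
Hypothesis p01 : 0 < p <= 1.
Hypothesis T0 : (0 < #|T|)%N.
Local Notation Z := ('I_r * 'I_t)%type.
Local Notation FF := {ffun Z -> T}.
Local Notation n := (#|T|%:R : R).
Implicit Types (phi psi : FF) (S : {set Z}).

Definition total_weight : R := n ^+ #|{: Z}| * p ^+ #|@pairs r t setT|.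

(** The first factor counts the possible overlaps, the second bounds the ways to map an overlap to
    the vertices of a given copy. *)
Definition ext_const : R := (2 ^ #|{: Z}| * #|{: Z}| ^ #|{: Z}|)%:R.

Let p0 : 0 < p. Proof. by case/andP: p01. Qed.
Let p1 : p <= 1. Proof. by case/andP: p01. Qed.
Let n0 : 0 < n. Proof. by rewrite ltr0n. Qed.

Lemma card_overlap phi S : (0 < #|{: Z}|)%N ->
  (#|[set psi : FF | overlap phi psi == S]| <= #|{: Z}| ^ #|{: Z}| * #|T| ^ (#|{: Z}| - #|S|))%N.
Proof.
move=> Z0; apply: (@leq_trans #|[set psi : FF | [forall z in S, psi z \in phi @: setT]]|).
  apply/subset_leq_card/subsetP => psi; rewrite !inE => /eqP <-.
  by apply/forall_inP => z; rewrite inE.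
rewrite card_ffun_in leq_mul2r; apply/orP; right.
have im : (#|phi @: setT| <= #|{: Z}|)%N.
  by apply: leq_trans (leq_imset_card _ _) _; rewrite cardsT.
apply: (@leq_trans (#|{: Z}| ^ #|S|)%N); first by case: #|S| => // k; rewrite leq_exp2r.
by apply: leq_pexp2l => //; apply: max_card.
Qed.

(** The summand is the conditional probability that the inner edges of [psi] are present, given
    those of [phi]. For a fixed overlap [S], the number of [psi] times the largest summand is at
    most a constant times [total_weight / set_weight n p S]. *)
Lemma extension_bound phi (P : pred {set Z}) (L : R) : (0 < #|{: Z}|)%N -> 0 < L ->
  (forall S, P S -> L <= set_weight n p S) ->
  \sum_(psi : FF | injectiveb psi && P (overlap phi psi)) p ^+ #|inner psi :\: inner phi|
  <= ext_const * (total_weight / L).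
Proof.
move=> Z0 L0 PL; rewrite (partition_big (overlap phi) P) => [|psi /andP[]] //=.
have tw0 : 0 <= total_weight / L.
  by rewrite divr_ge0 ?mulr_ge0 ?exprn_ge0 // ltW.
have bound S : P S ->
    \sum_(psi : FF | (injectiveb psi && P (overlap phi psi)) && (overlap phi psi == S))
      p ^+ #|inner psi :\: inner phi|
    <= (#|{: Z}| ^ #|{: Z}|)%:R * (total_weight / L).
  move=> PS; apply: le_trans (_ : \sum_(psi in [set psi : FF | overlap phi psi == S])
      p ^+ (#|@pairs r t setT| - #|pairs S|) <= _).
    rewrite [X in X <= _]big_mkcond [X in _ <= X]big_mkcond; apply: ler_sum => psi _.
    rewrite inE; case: eqP => [<-|_]; rewrite ?andbF // andbT.
    case: andP => [[/injectiveP inj _]|_]; last by rewrite exprn_ge0 // ltW.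
    by apply: ler_wiXn2l; rewrite ?card_innerD // ltW.
  rewrite sumr_const -[X in X <= _]mulr_natl.
  have subP : (#|pairs S| <= #|@pairs r t setT|)%N.
    apply/subset_leq_card/subsetP => D; rewrite !inE => /andP[_ ->].
    by rewrite subsetT.
  have w0 : 0 < set_weight n p S by apply: lt_le_trans (PL S PS).
  have eqw : n ^+ (#|{: Z}| - #|S|) * p ^+ (#|@pairs r t setT| - #|pairs S|) * set_weight n p S
      = total_weight.
    rewrite /set_weight /total_weight mulrACA -!exprD !subnK //.
    exact: max_card.
  apply: le_trans (_ : (#|{: Z}| ^ #|{: Z}| * #|T| ^ (#|{: Z}| - #|S|))%:R *
     p ^+ (#|@pairs r t setT| - #|pairs S|) <= _).
    by rewrite ler_wpM2r ?exprn_ge0 ?(ltW p0) // ler_nat card_overlap.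
  rewrite natrM [(#|T| ^ _)%:R]natrX -mulrA ler_wpM2l // ler_pdivlMr // -eqw.
  apply: ler_wpM2l; last exact: PL.
  by apply: mulr_ge0; apply: exprn_ge0; apply: ltW.
apply: le_trans (ler_sum _ bound) _.
move: tw0; set w := total_weight / L => tw0.
rewrite sumr_const -[X in X <= _]mulr_natl mulrA -natrM /ext_const ler_wpM2r // ler_nat leq_mul2r.
apply/orP; right; apply: leq_trans (max_card _) _.
by rewrite -cardsT -powersetT card_powerset cardsT.
Qed.

End Extensions.

(** * Second moment of the number of copies *)

Section SecondMoment.
Variables (R : realFieldType) (T : finType) (r t : nat) (p : R).
Hypothesis p01 : 0 < p <= 1.
Hypothesis T0 : (0 < #|T|)%N.
Local Notation Z := ('I_r * 'I_t)%type.
Local Notation FF := {ffun Z -> T}.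
Local Notation n := (#|T|%:R : R).
Hypothesis Z0 : (0 < #|{: Z}|)%N.
Variable Phi : {set FF}.
Hypothesis Phi_inj : forall phi, phi \in Phi -> injective phi.
Implicit Types (phi psi : FF) (S : {set Z}) (H : graph T).

Definition alive phi H : bool := inner phi \subset H.

Definition alive_count H : R := \sum_(phi in Phi) (alive phi H)%:R.

Definition mean_count : R := #|Phi|%:R * p ^+ #|@pairs r t setT|.

Definition pair_count (P : pred {set Z}) H : R :=
  \sum_(phi in Phi) \sum_(psi in Phi | P (overlap phi psi)) (alive phi H)%:R * (alive psi H)%:R.

Let p0 : 0 < p. Proof. by case/andP: p01. Qed.
Let p1 : p <= 1. Proof. by case/andP: p01. Qed.

Lemma expect_alive phi : phi \in Phi ->
  expect p (fun H => (alive phi H)%:R) = p ^+ #|@pairs r t setT|.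
Proof. by move=> phiP; rewrite expect_subset card_inner //; apply: Phi_inj. Qed.

Lemma expect_alive_count : expect p alive_count = mean_count.
Proof.
rewrite expect_sum (eq_bigr (fun=> p ^+ #|@pairs r t setT|)) => [|phi].
  by rewrite sumr_const /mean_count mulr_natl.
exact: expect_alive.
Qed.

Lemma expect_alive2 phi psi : phi \in Phi ->
  expect p (fun H => (alive phi H)%:R * (alive psi H)%:R) =
  p ^+ #|@pairs r t setT| * p ^+ #|inner psi :\: inner phi|.
Proof.
move=> phiP; rewrite -exprD -(card_inner (Phi_inj phiP)).
rewrite (_ : (#|inner phi| + _)%N = #|inner phi :|: inner psi|); last first.
  by rewrite -[RHS](cardsID (inner phi)) (setIidPr (subsetUl _ _)) setDUl setDv set0U.
rewrite -expect_subset; apply: eq_expect => H.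
by rewrite /alive -natrM mulnb subUset.
Qed.

Lemma expect_pair_count (P : pred {set Z}) (L : R) : 0 < L ->
  (forall S, P S -> L <= set_weight n p S) ->
  expect p (pair_count P) <= mean_count * (ext_const R r t * (total_weight T r t p / L)).
Proof.
move=> L0 PL; rewrite expect_sum /mean_count -mulrA mulr_natl.
rewrite -sumr_const; apply: ler_sum => phi phiP.
rewrite expect_sum (eq_bigr (fun psi =>
  p ^+ #|@pairs r t setT| * p ^+ #|inner psi :\: inner phi|)); last first.
  by move=> psi _; apply: expect_alive2.
rewrite -mulr_sumr ler_wpM2l ?exprn_ge0 ?(ltW p0) //.
apply: le_trans (extension_bound p01 T0 phi Z0 L0 PL).
rewrite [X in X <= _]big_mkcond [X in _ <= X]big_mkcond; apply: ler_sum => psi _.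
case: andP => [[psiP ->]|_]; last by case: ifP => // _; rewrite exprn_ge0 // ltW.
by have /injectiveP -> := Phi_inj psiP.
Qed.

Lemma alive_count_sqr H : alive_count H ^+ 2 = pair_count (fun S => pairs S != set0) H +
  pair_count (fun S => pairs S == set0) H.
Proof.
rewrite expr2 /alive_count mulr_suml /pair_count -big_split.
apply: eq_bigr => phi phiP; rewrite mulr_sumr /=.
rewrite (bigID (fun psi => pairs (overlap phi psi) != set0)) /=.
by congr (_ + _); apply: eq_bigl => psi; rewrite negbK.
Qed.

(** Copies whose overlap contains no pair inside a row share no inner edge, so they are alive
    independently of each other. *)
Lemma expect_disjoint_pair_count :
  expect p (pair_count (fun S => pairs S == set0)) <= mean_count ^+ 2.
Proof.
rewrite expect_sum expr2 [X in X * _]/mean_count -mulrA mulr_natl.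
rewrite -sumr_const; apply: ler_sum => phi phiP.
rewrite expect_sum (eq_bigr (fun psi =>
  p ^+ #|@pairs r t setT| * p ^+ #|inner psi :\: inner phi|)); last first.
  by move=> psi _; apply: expect_alive2.
rewrite -mulr_sumr ler_wpM2l ?exprn_ge0 ?(ltW p0) //.
rewrite /mean_count mulr_natl -sumr_const big_mkcondr; apply: ler_sum => psi psiP.
case: eqP => [ov|_]; last by rewrite exprn_ge0 // ltW.
apply: ler_wiXn2l => //; first exact: ltW.
by have := card_innerD phi (Phi_inj psiP); rewrite ov cards0 subn0.
Qed.

(** The independent pairs of copies are absorbed by the square of the mean; what remains is the
    expected number of dependent pairs. *)
Lemma variance_bound (L : R) : 0 < L ->
  (forall S : {set Z}, pairs S != set0 -> L <= set_weight n p S) ->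
  expect p (fun H => (alive_count H - mean_count) ^+ 2) <=
  mean_count * (ext_const R r t * (total_weight T r t p / L)).
Proof.
move=> L0 PL.
have -> : expect p (fun H => (alive_count H - mean_count) ^+ 2) =
    expect p (fun H => pair_count (fun S => pairs S != set0) H) +
    (expect p (fun H => pair_count (fun S => pairs S == set0) H) - mean_count ^+ 2).
  rewrite (@eq_expect _ _ _ _ (fun H => pair_count (fun S => pairs S != set0) H +
     (pair_count (fun S => pairs S == set0) H +
     ((- (2 * mean_count)) * alive_count H + mean_count ^+ 2 * 1)))) => [|H].
    by rewrite !expectD !expectZ expect1 expect_alive_count; ring.
  by rewrite sqrrB alive_count_sqr -mulr_natl; ring.
rewrite -[X in _ <= X]addr0; apply: lerD; first exact: expect_pair_count.
by rewrite subr_le0 expect_disjoint_pair_count.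
Qed.

End SecondMoment.

(** * Random graphs in which Maker wins *)

Section GoodGraph.
Variables (R : realFieldType) (T : finType) (r t : nat) (G : graph T).
Local Notation Z := ('I_r * 'I_t)%type.
Local Notation FF := {ffun Z -> T}.
Implicit Types (phi psi : FF) (S : {set Z}) (H : graph T).

Definition embeddings : {set FF} := [set phi | embedding (adjacency G) phi].

Lemma embeddings_inj phi : phi \in embeddings -> injective phi.
Proof. by rewrite inE => /andP[/injectiveP]. Qed.

Definition clique phi : graph T := complete_on (phi @: setT).

Lemma card_clique phi : (#|clique phi| <= 2 ^ (r * t))%N.
Proof.
rewrite -(card_imset _ val_inj); apply: (@leq_trans #|powerset (phi @: setT)|).
  by apply/subset_leq_card/subsetP => X /imsetP[e]; rewrite inE powersetE => eS ->.
rewrite card_powerset leq_exp2l //; apply: leq_trans (leq_imset_card _ _) _.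
by rewrite cardsT card_prod !card_ord.
Qed.

Lemma cliqueP phi (e : edge T) : e \in clique phi ->
  exists y z, y != z /\ val e = phi @: [set y; z].
Proof.
rewrite inE => eS; have /cards2P[a [b [ab eab]]] : #|val e| == 2 := valP e.
have /imsetP[y _ ya] : a \in phi @: setT by apply: (subsetP eS); rewrite eab !inE eqxx.
have /imsetP[z _ zb] : b \in phi @: setT.
  by apply: (subsetP eS); rewrite eab !inE eqxx orbT.
exists y, z; rewrite imsetU1 imset_set1 -ya -zb; split=> //.
by apply: contra ab => /eqP yz; rewrite ya zb yz.
Qed.

Lemma clique_inner phi (e : edge T) (y z : Z) : y != z -> y.1 = z.1 ->
  val e = phi @: [set y; z] -> e \in inner phi.
Proof.
move=> yz row eyz; rewrite inE; apply/existsP; exists [set y; z].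
rewrite eyz eqxx andbT inE subsetT cards2 yz /=.
by apply/forall_inP => a /set2P[] ->; apply/forall_inP => b /set2P[] ->; rewrite ?row.
Qed.

Lemma clique_board phi H : phi \in embeddings -> alive phi H ->
  clique phi \subset G :|: H.
Proof.
rewrite inE => /andP[_ /forallP adj] al; apply/subsetP => e /cliqueP[y [z [yz eyz]]].
rewrite inE; have [row|row] := eqVneq y.1 z.1.
  by rewrite (subsetP al) ?orbT // (clique_inner yz row).
have /forallP/(_ z) := adj y; rewrite row => /existsP[e' /andP[e'G /eqP e'yz]].
suff -> : e = e' by rewrite e'G.
by apply: val_inj; rewrite eyz e'yz imsetU1 imset_set1.
Qed.

Lemma contains_clique_clique phi : phi \in embeddings ->
  contains_clique (t * r) (clique phi).
Proof.
move=> phiP; exists (phi @: setT); split=> //.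
by rewrite (card_imset _ (embeddings_inj phiP)) cardsT card_prod !card_ord mulnC.
Qed.

Lemma clique_gt1 phi : phi \in embeddings -> (2 < t * r)%N -> (1 < #|clique phi|)%N.
Proof.
move=> phiP; have [S [Sk SA]] := contains_clique_clique phiP.
rewrite -Sk => S3; apply: leq_trans (subset_leq_card SA).
have [a aS] : exists a, a \in S by apply/card_gt0P; apply: leq_trans S3.
have : (1 < #|S :\ a|)%N by move: S3; rewrite (cardsD1 a S) aS.
case/card_gt1P => b [c [bS cS bc]].
move: bS cS; rewrite !inE => /andP[ba bS] /andP[ca cS].
have cab x : x != a -> #|[set a; x]| == 2 by rewrite cards2 eq_sym => ->.
pose ab : edge T := exist (fun e : {set T} => #|e| == 2) [set a; b] (cab b ba).
pose ac : edge T := exist (fun e : {set T} => #|e| == 2) [set a; c] (cab c ca).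
apply/card_gt1P; exists ab, ac.
split; rewrite ?inE /=.
- by apply/subsetP => x /set2P[] ->.
- by apply/subsetP => x /set2P[] ->.
rewrite -val_eqE /=; apply/eqP => /setP/(_ b).
by rewrite !inE eqxx orbT (negbTE ba) (negbTE bc).
Qed.

(* Two distinct edges of a copy span at least three vertices; these lie in one
   part only if both edges are inner, hence random. *)
Definition crowded S := (2 < #|S|)%N && single_row S.
Definition spread S := (2 < #|S|)%N && ~~ single_row S.

Definition crossing (P : pred {set Z}) phi H : {set FF} :=
  [set psi in embeddings | alive psi H && P (overlap phi psi)].

Lemma in_crossing (P : pred {set Z}) phi psi H : (psi \in crossing P phi H) =
  (psi \in embeddings) && (alive psi H && P (overlap phi psi)).
Proof. by rewrite /crossing in_set. Qed.

Variables (B1 B2 : R).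

Definition good_cliques H : {set FF} := [set phi in embeddings |
  [&& alive phi H, #|crossing crowded phi H|%:R <= B1 & #|crossing spread phi H|%:R <= B2]].

Lemma in_good_cliques phi H : (phi \in good_cliques H) = (phi \in embeddings) &&
  [&& alive phi H, #|crossing crowded phi H|%:R <= B1 & #|crossing spread phi H|%:R <= B2].
Proof. by rewrite /good_cliques in_set. Qed.

Hypotheses (B1_ge0 : 0 <= B1) (B2_ge0 : 0 <= B2).

(** Fix one good copy [phi] through both edges. Every other such copy [psi] meets it in at least
    three vertices, so it is counted by a crossing number of [phi]. If the overlap lies in one row,
    then [x] is an inner edge of [psi] and hence in [H]; this is why [B1] is charged to random edges
    only. *)
Lemma codegree_good H (x y : edge T) : x != y ->
  (codegree (good_cliques H) clique x y)%:R <= B2 + (x \in H)%:R * B1.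
Proof.
move=> xy; rewrite /codegree; set C := [set _ in _ | _].
have [->|[phi]] := set_0Vmem C.
  by rewrite cards0 addr_ge0 // mulr_ge0.
rewrite !inE => /andP[/and4P[_ _ c1 c2] /andP[xphi yphi]].
have C_sub psi : psi \in C ->
    [/\ psi \in embeddings, alive psi H, (2 < #|overlap phi psi|)%N &
        x \notin H -> ~~ single_row (overlap phi psi)].
  rewrite inE => /andP[]; rewrite inE => /andP[psiP /and3P[al _ _]] /andP[xpsi ypsi].
  have /cliqueP[a [b [ab xab]]] := xpsi; have /cliqueP[c [d [cd ycd]]] := ypsi.
  have sub (u v : Z) (e : edge T) : val e \subset phi @: setT -> val e = psi @: [set u; v] ->
      [set u; v] \subset overlap phi psi.
    move=> /subsetP ephi euv; apply/subsetP => w wuv; rewrite inE.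
    by apply: ephi; rewrite euv imset_f.
  have sx := sub a b x xphi xab; have sy := sub c d y yphi ycd.
  split=> // [|xH].
    apply: leq_trans (_ : #|[set a; b] :|: [set c; d]| <= _)%N; last first.
      by apply: subset_leq_card; rewrite subUset sx sy.
    have : [set a; b] \proper [set a; b] :|: [set c; d].
      rewrite properE subsetUl /=; apply: contra xy => sub2.
      have : [set c; d] \subset [set a; b] := subset_trans (subsetUr _ _) sub2.
      move=> sub3; apply/eqP/val_inj; rewrite xab ycd; apply: (congr1 (fun D : {set Z} => psi @: D)).
      by apply/eqP; rewrite eq_sym eqEcard sub3 !cards2 ab cd.
    by move/proper_card; rewrite {1}cards2 ab.
  apply: contra xH => /forall_inP/(_ a) ; rewrite (subsetP sx) ?inE ?eqxx //.
  move=> /(_ isT)/forall_inP/(_ b); rewrite (subsetP sx) ?inE ?eqxx ?orbT //.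
  by move=> /(_ isT)/eqP row; rewrite (subsetP al) // (clique_inner ab row).
case: (boolP (x \in H)) => xH; rewrite ?mul1r ?mul0r ?addr0.
  apply: le_trans (lerD c2 c1); rewrite -natrD ler_nat.
  apply: leq_trans (_ : #|crossing spread phi H :|: crossing crowded phi H| <= _)%N.
    apply/subset_leq_card/subsetP => psi /C_sub[psiP al ov _].
    rewrite in_setU !in_crossing /spread /crowded psiP al ov /=.
    by case: single_row.
  by rewrite cardsU leq_subr.
apply: le_trans c2; rewrite ler_nat; apply/subset_leq_card/subsetP => psi.
by case/C_sub => psiP al ov /(_ xH) row; rewrite in_crossing /spread psiP al ov row.
Qed.

Lemma maker_wins_good (first : player) H : (2 < t * r)%N ->
  2 ^+ (2 ^ (r * t)).+1 * (#|G :|: H|%:R * B2 + #|H|%:R * B1) < #|good_cliques H|%:R ->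
  maker_wins_clique first (G :|: H) (t * r).
Proof.
move=> tr big; have good phi : phi \in good_cliques H -> phi \in embeddings /\ alive phi H.
  by rewrite inE => /and3P[].
(* The exponent [2 ^ (r * t)] is a crude bound on the number of edges of a copy: it counts all
   vertex subsets. *)
apply: (@beck_criterion R T _ (good_cliques H) clique
  (fun x => B2 + (x \in H)%:R * B1) (2 ^ (r * t))%N) => //.
- exact: card_clique.
- by move=> x y; apply: codegree_good.
- by move=> x; rewrite addr_ge0 // mulr_ge0.
- by move=> phi /good[]; apply: clique_board.
- by move=> phi /good[phiP _]; apply: clique_gt1.
- by move=> phi /good[phiP _]; apply: contains_clique_clique.
rewrite big_split /= sumr_const -mulr_suml -natr_sum -[B2 *+ _]mulr_natl.
rewrite (_ : (\sum_(x in G :|: H) (x \in H) = #|H|)%N) //.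
rewrite -sum1_card [LHS]big_mkcond [RHS]big_mkcond; apply: eq_bigr => x _.
by rewrite inE; case: (x \in H); rewrite ?orbT // if_same.
Qed.

End GoodGraph.

(** An alive copy that is discarded has a crossing number above [B1] or [B2], so it contributes at
    least 1 to one of the subtracted quotients. *)
Lemma good_cliques_many (R : realFieldType) (T : finType) (r t : nat) (G : graph T)
    (B1 B2 : R) (H : graph T) : 0 < B1 -> 0 < B2 ->
  alive_count R (@embeddings T r t G) H
    - pair_count R (@embeddings T r t G) (@crowded r t) H / B1
    - pair_count R (@embeddings T r t G) (@spread r t) H / B2
  <= #|@good_cliques R T r t G B1 B2 H|%:R.
Proof.
move=> B10 B20.
have pcE P : pair_count R (@embeddings T r t G) P H =
    \sum_(phi in @embeddings T r t G) (alive phi H)%:R * #|crossing G P phi H|%:R.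
  apply: eq_bigr => phi _; rewrite -mulr_sumr; congr (_ * _).
  rewrite -sum1_card natr_sum big_mkcondr [RHS]big_mkcond [LHS]big_mkcond.
  apply: eq_bigr => psi _; rewrite in_crossing.
  by case: (psi \in _); case: alive; case: (P _).
rewrite !pcE !mulr_suml -!sumrB -sum1_card natr_sum.
rewrite [X in _ <= X]big_mkcond [X in X <= _]big_mkcond; apply: ler_sum => phi _.
rewrite in_good_cliques; case: (phi \in _) => //=.
case: (alive phi H) => /=; last by rewrite !mul0r !subr0.
rewrite !mul1r; set x := #|_|%:R; set y := #|_|%:R.
have x0 : 0 <= x / B1 by rewrite divr_ge0 // ltW.
have y0 : 0 <= y / B2 by rewrite divr_ge0 // ltW.
case: (leP x B1) => hx /=; last first.
  by have : 1 <= x / B1 by [rewrite ler_pdivlMr // mul1r ltW]; lra.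
case: (leP y B2) => hy /=; first by lra.
by have : 1 <= y / B2 by [rewrite ler_pdivlMr // mul1r ltW]; lra.
Qed.

Lemma card_edge (T : finType) : (#|{: edge T}| <= #|T| ^ 2)%N.
Proof.
rewrite card_sub -cardsE card_draws bin2 -mulnn.
by apply: leq_trans (half_leq (leq_mul (leqnn _) (leq_pred _))) _; lia.
Qed.

(** * Probability that Maker fails *)

Section FailureBound.
Variables (R : realFieldType) (T : finType) (r t : nat) (G : graph T).
Variables (first : player) (p mu c : R).
Hypotheses (t2 : (2 <= t)%N) (r2 : (2 <= r)%N) (T0 : (0 < #|T|)%N).
Hypotheses (p01 : 0 < p <= 1) (mu1 : 1 <= mu) (c0 : 0 < c).
Local Notation n := (#|T|%:R : R).
Hypothesis dense : (mu ^+ 3) ^+ 2 <= n ^+ 2 * p ^+ t.+1.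
Hypothesis many : c * n ^+ (r * t) <= #|@embeddings T r t G|%:R.
Hypothesis mu_big : 2 ^+ (2 ^ (r * t)).+4 <= c * mu.

(* [B1] and [B2] exceed the expected numbers of copies meeting a given copy in a
   crowded or a spread set by a factor of order [mu]. *)
Let W := total_weight T r t p.
Let M := mean_count p (@embeddings T r t G).
Let K := ext_const R r t.
Let B1 := W * mu / (n ^+ 2 * p * mu ^+ 3).
Let B2 := W * mu / (n ^+ 2 * mu ^+ 3).

Let p0 : 0 < p. Proof. by case/andP: p01. Qed.
Let n0 : 0 < n. Proof. by rewrite ltr0n. Qed.
Let mu0 : 0 < mu. Proof. exact: lt_le_trans mu1. Qed.
Let l1 : 1 <= mu ^+ 3. Proof. exact: exprn_ege1. Qed.
Let W0 : 0 < W. Proof. by rewrite mulr_gt0 ?exprn_gt0. Qed.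
Let N0 : 0 < n ^+ 2 * p. Proof. by rewrite mulr_gt0 ?exprn_gt0. Qed.
Let B10 : 0 < B1. Proof. by rewrite divr_gt0 ?mulr_gt0 ?exprn_gt0. Qed.
Let B20 : 0 < B2. Proof. by rewrite divr_gt0 ?mulr_gt0 ?exprn_gt0. Qed.
Let K0 : 0 <= K. Proof. exact: ler0n. Qed.

Let cWM : c * W <= M.
Proof.
rewrite /W /M /total_weight /mean_count mulrA ler_wpM2r ?exprn_ge0 ?(ltW p0) //.
by rewrite card_prod !card_ord.
Qed.

Let M0 : 0 < M. Proof. by apply: lt_le_trans cWM; rewrite mulr_gt0. Qed.

Let Z0 : (0 < #|{: 'I_r * 'I_t}|)%N.
Proof. by rewrite card_prod !card_ord muln_gt0 (ltnW r2) (ltnW t2). Qed.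

Let deviation (H : graph T) : R := (alive_count R (@embeddings T r t G) H - M) ^+ 2.
Let crowding (H : graph T) : R := pair_count R (@embeddings T r t G) (@crowded r t) H.
Let spreading (H : graph T) : R := pair_count R (@embeddings T r t G) (@spread r t) H.

Let MM : 0 <= 4 / M ^+ 2.
Proof. exact: ltW (divr_gt0 (ltr0Sn R 3) (exprn_gt0 2 M0)). Qed.
Let MB1 : 0 <= 4 / M / B1.
Proof. exact: ltW (divr_gt0 (divr_gt0 (ltr0Sn R 3) M0) B10). Qed.
Let MB2 : 0 <= 4 / M / B2.
Proof. exact: ltW (divr_gt0 (divr_gt0 (ltr0Sn R 3) M0) B20). Qed.

(* A single application of Markov's inequality excludes that there are too few
   copies, too many random edges, or too many overlapping copies. *)
Definition badness (H : graph T) : R :=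
  4 / M ^+ 2 * deviation H + ((n ^+ 2 * p * mu)^-1 * #|H|%:R
  + (4 / M / B1 * crowding H + 4 / M / B2 * spreading H)).

Let pair_count_ge0 P H : 0 <= pair_count R (@embeddings T r t G) P H.
Proof. by apply: sumr_ge0 => phi _; apply: sumr_ge0 => psi _; apply: mulr_ge0. Qed.

Lemma badness_ge0 H : 0 <= badness H.
Proof.
have cr := pair_count_ge0 (@crowded r t) H; have sp := pair_count_ge0 (@spread r t) H.
apply: addr_ge0; first by apply: mulr_ge0 => //; apply: sqr_ge0.
apply: addr_ge0; last by apply: addr_ge0; apply: mulr_ge0.
by apply: mulr_ge0 => //; rewrite invr_ge0 ltW // mulr_gt0.
Qed.

(** The parameter [l] of the weight bounds is [mu ^+ 3]. The deviation contributes [4 * K / c / mu]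
    by the variance bound, as [c * W <= M] and [mu <= n ^+ 2 * p]; the random edges contribute
    [1 / mu], and each kind of crossing [4 * K / mu]. *)
Lemma expect_badness : expect p badness <= (4 * K / c + 8 * K + 1) / mu.
Proof.
have N_mu : mu <= n ^+ 2 * p.
  have np : mu ^+ 3 <= n * p := np_ge p01 l1 (ltW n0) t2 dense.
  have mu3 : mu <= mu ^+ 3 by rewrite exprS ler_peMr ?exprn_ege1 // ltW.
  apply: le_trans mu3 _; apply: le_trans np _.
  by rewrite expr2 -mulrA ler_peMl ?mulr_ge0 ?(ltW p0) // ler1n.
have hV : expect p deviation <= M * (K * (W / (n ^+ 2 * p))).
  apply: variance_bound => //; first exact: embeddings_inj.
  by move=> S; apply: (set_weight_pair p01 l1 (ltW n0) t2 dense).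
have hC : expect p crowding <= M * (K * (W / (n ^+ 2 * p * mu ^+ 3))).
  apply: expect_pair_count => //; first exact: embeddings_inj.
    by rewrite mulr_gt0 ?exprn_gt0.
  by move=> S /andP[]; apply: (set_weight_single_row p01 l1 (ltW n0) t2 dense).
have hS : expect p spreading <= M * (K * (W / (n ^+ 2 * mu ^+ 3))).
  apply: expect_pair_count => //; first exact: embeddings_inj.
    by rewrite mulr_gt0 ?exprn_gt0.
  by move=> S /andP[]; apply: (set_weight_not_single_row p01 l1 (ltW n0) t2 dense).
rewrite /badness !expectD !expectZ expect_card.
have h1 : 4 / M ^+ 2 * expect p deviation <= 4 * K / c / mu.
  apply: le_trans (_ : 4 / M ^+ 2 * (M * (K * (W / (n ^+ 2 * p)))) <= _).
    exact: ler_wpM2l.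
  have -> : 4 / M ^+ 2 * (M * (K * (W / (n ^+ 2 * p)))) = 4 * K * (W / M / (n ^+ 2 * p)).
    by field; rewrite !gt_eqF.
  have -> : 4 * K / c / mu = 4 * K * (c^-1 * mu^-1) by rewrite !mulrA.
  apply: ler_wpM2l; first by rewrite mulr_ge0.
  apply: ler_pM.
  - by rewrite divr_ge0 // ltW.
  - by rewrite invr_ge0 ltW.
  - by rewrite ler_pdivrMr // mulrC ler_pdivlMr // mulrC.
  by rewrite lef_pV2 ?posrE.
have h2 : (n ^+ 2 * p * mu)^-1 * (#|{: edge T}|%:R * p) <= 1 / mu.
  have -> : 1 / mu = (n ^+ 2 * p * mu)^-1 * (n ^+ 2 * p).
    by field; rewrite !gt_eqF.
  rewrite ler_wpM2l ?invr_ge0 ?(ltW (mulr_gt0 N0 mu0)) // ler_wpM2r ?(ltW p0) //.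
  by rewrite -natrX ler_nat card_edge.
have h3 : 4 / M / B1 * expect p crowding <= 4 * K / mu.
  apply: le_trans (_ : 4 / M / B1 * (M * (K * (W / (n ^+ 2 * p * mu ^+ 3)))) <= _).
    exact: ler_wpM2l.
  by rewrite /B1 le_eqVlt; apply/orP; left; apply/eqP; field; rewrite !gt_eqF.
have h4 : 4 / M / B2 * expect p spreading <= 4 * K / mu.
  apply: le_trans (_ : 4 / M / B2 * (M * (K * (W / (n ^+ 2 * mu ^+ 3)))) <= _).
    exact: ler_wpM2l.
  by rewrite /B2 le_eqVlt; apply/orP; left; apply/eqP; field; rewrite !gt_eqF.
apply: le_trans (lerD h1 (lerD h2 (lerD h3 h4))) _.
by rewrite le_eqVlt; apply/orP; left; apply/eqP; ring.
Qed.

(** All summands of [badness] are nonnegative, so each is below 1. Hence at least [M / 2] copies are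
    alive, fewer than [M / 4] are lost by discarding, and more than [M / 4] good ones remain. *)
Lemma maker_wins_badness H : badness H < 1 ->
  maker_wins_clique first (G :|: H) (t * r).
Proof.
move=> bad.
have d0 : 0 <= 4 / M ^+ 2 * deviation H.
  by apply: mulr_ge0 => //; apply: sqr_ge0.
have e0 : 0 <= (n ^+ 2 * p * mu)^-1 * #|H|%:R.
  by rewrite mulr_ge0 // invr_ge0 ltW // mulr_gt0.
have c_ge0 : 0 <= 4 / M / B1 * crowding H.
  by apply: mulr_ge0 => //; apply: pair_count_ge0.
have s_ge0 : 0 <= 4 / M / B2 * spreading H.
  by apply: mulr_ge0 => //; apply: pair_count_ge0.
have [lt1 lt2 lt3] : [/\ 4 / M ^+ 2 * deviation H < 1, (n ^+ 2 * p * mu)^-1 * #|H|%:R < 1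
    & 4 / M / B1 * crowding H + 4 / M / B2 * spreading H < 1].
  move: bad d0 e0 c_ge0 s_ge0; rewrite /badness.
  move: (4 / M ^+ 2 * _) (_^-1 * _) (4 / M / B1 * _) (4 / M / B2 * _) => w x y z.
  by move=> *; split; lra.
have hX : M / 2 <= alive_count R (@embeddings T r t G) H.
  rewrite leNgt; apply/negP => small.
  have : (M / 2) ^+ 2 <= deviation H.
    rewrite /deviation -[X in _ <= X]sqrrN opprB.
    move: (alive_count _ _ _) small => X small.
    have M2 : 0 <= M / 2 by apply: divr_ge0 => //; apply: ltW.
    have h : M / 2 <= M - X by lra.
    by apply: lerXn2r (h); rewrite nnegrE //; apply: le_trans h.
  (* A deviation of [M / 2] would make the first summand at least
     [4 / M ^+ 2 * (M / 2) ^+ 2 = 1]. *)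
  move=> le; have := le_lt_trans (ler_wpM2l MM le) lt1; apply/negP; rewrite -leNgt.
  by rewrite le_eqVlt; apply/orP; left; apply/eqP; field; rewrite gt_eqF.
have hH : #|H|%:R <= n ^+ 2 * p * mu.
  by move/ltW: lt2; rewrite mulrC ler_pdivrMr ?mul1r // mulr_gt0.
have hQ : crowding H / B1 + spreading H / B2 < M / 4.
  move: lt3; have -> : 4 / M / B1 * crowding H + 4 / M / B2 * spreading H =
      (crowding H / B1 + spreading H / B2) / (M / 4).
    by field; rewrite !gt_eqF.
  by rewrite ltr_pdivrMr ?mul1r // divr_gt0.
have hF := @good_cliques_many R T r t G B1 B2 H B10 B20.
apply: (@maker_wins_good R T r t G B1 B2 (ltW B10) (ltW B20)).
  by apply: (@leq_trans (2 * 2)%N) => //; apply: leq_mul.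
apply: le_lt_trans (_ : M / 4 < _); last first.
  by move: hF hQ hX; rewrite -/(crowding H) -/(spreading H); lra.
(* The spread codegrees are summed over all edges of the board, at most [n ^+ 2]; the crowded ones
   only over the at most [n ^+ 2 * p * mu] random edges. *)
have b2 : #|G :|: H|%:R * B2 <= W / mu.
  apply: le_trans (_ : n ^+ 2 * B2 <= _).
    rewrite ler_wpM2r ?(ltW B20) // -natrX ler_nat.
    by apply: leq_trans (card_edge T); apply: max_card.
  have -> : n ^+ 2 * B2 = W / mu * mu^-1 by rewrite /B2; field; rewrite !gt_eqF.
  rewrite ler_piMr ?divr_ge0 ?(ltW W0) ?(ltW mu0) //.
  by rewrite invf_le1.
have b1 : #|H|%:R * B1 <= W / mu.
  apply: le_trans (ler_wpM2r (ltW B10) hH) _.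
  by rewrite /B1 le_eqVlt; apply/orP; left; apply/eqP; field; rewrite !gt_eqF.
(* The step from [.+1] to [.+4] in [mu_big] is a factor 8: 2 for the two sums just bounded and 4 for
   the fraction [M / 4]. *)
apply: le_trans (_ : 2 ^+ (2 ^ (r * t)).+1 * (2 * (W / mu)) <= _).
  by rewrite ler_wpM2l ?exprn_ge0 //; lra.
apply: le_trans (_ : c * W / 4 <= _); last by apply: ler_wpM2r => //; rewrite invr_ge0.
have : 2 ^+ (2 ^ (r * t)).+4 * (W / mu) <= c * mu * (W / mu).
  by rewrite ler_wpM2r // divr_ge0 // ltW.
have -> : c * mu * (W / mu) = c * W by field; rewrite gt_eqF.
set w := W / mu; rewrite !exprS; set x := 2 ^+ _; set y := c * W.
by lra.
Qed.

End FailureBound.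

(** * Asymptotics *)

From mathcomp Require Import all_classical all_reals all_analysis.
Import numFieldNormedType.Exports.
Local Open Scope classical_set_scope.

Section GnpProb.
Variables (R : realType) (T : finType) (p : R).
Hypothesis p01 : 0 < p <= 1.

Lemma gnp_prob_le1 (A : graph T -> Prop) : gnp_prob p A <= 1.
Proof.
rewrite -(expect1 T p) /gnp_prob /expect big_mkcond; apply: ler_sum => H _.
by rewrite mulr1; case: ifP => // _; apply: gnp_weight_ge0.
Qed.

(** Markov's inequality: [1 - Y H] is pointwise at most the indicator of [A]. *)
Lemma gnp_prob_ge (A : graph T -> Prop) (Y : graph T -> R) :
  (forall H, 0 <= Y H) -> (forall H, Y H < 1 -> A H) -> 1 - expect p Y <= gnp_prob p A.
Proof.
move=> Y0 YA; rewrite -(expect1 T p) /gnp_prob /expect -sumrB [leRHS]big_mkcond.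
apply: ler_sum => H _; have w0 := gnp_weight_ge0 p01 H.
rewrite -mulrBr; case: asboolP => [_|nA].
  by rewrite ler_piMr // gerBl.
rewrite mulr_ge0_le0 // subr_le0 leNgt; apply/negP => /YA; exact: nA.
Qed.

End GnpProb.

(** A set of fewer than [r] vertices has at most [r - 1] elements, whence the value
    [1 - (r - 1) * (1 - alpha)] for the proportion of common neighbours. *)
Lemma embeddings_dense (R : realType) (alpha : R) (r t : nat) (T : finType) (G : graph T) :
  (0 < t)%N -> (0 < r)%N -> (0 < #|T|)%N -> alpha <= 1 ->
  0 <= 1 - (r%:R - 1) * (1 - alpha) ->
  alpha * #|T|%:R <= (min_degree G)%:R ->
  ((1 - (r%:R - 1) * (1 - alpha)) ^+ r) ^+ (t ^ r) - (r * t)%:R ^+ 2 / #|T|%:R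
   <= #|@embeddings T r t G|%:R / #|T|%:R ^+ (r * t).
Proof.
move=> t0 r0 T0 alpha1 eps0 deg.
have := @density_embedding R T (adjacency G) r t (Ordinal t0)
  (1 - (r%:R - 1) * (1 - alpha)) (@adjacency_sym T G) T0 eps0.
rewrite /density card_ffun card_prod !card_ord natrX; apply.
move=> S Sr; apply: le_trans (common_neighbours S deg).
rewrite ler_wpM2r //.
have : #|S|%:R <= r%:R - 1 :> R by rewrite -(prednK r0) -natr1 addrK ler_nat; lia.
by move=> h; rewrite lerD2l lerN2 ler_wpM2r // subr_ge0.
Qed.

Lemma powR_near_ge (R : realType) (a K : R) : 0 < a ->
  \forall n \near \oo, K <= n%:R `^ a.
Proof.
move=> a0; near=> n.
(* The bound [K] may be negative, so its positive part is used when inverting the power. *)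
have K0 : 0 <= Num.max K 0 by rewrite le_max lexx orbT.
apply: (@le_trans _ _ (Num.max K 0)); first by rewrite le_max lexx.
rewrite -[leLHS](_ : (Num.max K 0 `^ a^-1) `^ a = _); last first.
  by rewrite -powRrM mulVf ?gt_eqF // powRr1.
apply: ge0_ler_powR; rewrite ?nnegrE ?powR_ge0 ?(ltW a0) ?ler0n //.
near: n; exact: nbhs_infty_ger.
Unshelve. all: by end_near. Qed.

(** With [p] replaced by its lower bound, both sides are [n] to the power [gamma * (t + 1)]: on the
    right [2 - (t + 1) * 2 / (t + 1)] vanishes, and on the left the denominator 6 cancels the cube
    and the square. *)
Lemma edge_probability_dense (R : realType) (gamma p : R) (n t : nat) : (0 < n)%N ->
  n%:R `^ (- (2 / (t%:R + 1)) + gamma) <= p ->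
  ((n%:R `^ (gamma * (t%:R + 1) / 6)) ^+ 3) ^+ 2 <= n%:R ^+ 2 * p ^+ t.+1.
Proof.
move=> n0 hp; have n0' : 0 < n%:R :> R by rewrite ltr0n.
have t1 : t%:R + 1 != 0 :> R by rewrite natr1 pnatr_eq0.
apply: (@le_trans _ _ (n%:R ^+ 2 * (n%:R `^ (- (2 / (t%:R + 1)) + gamma)) ^+ t.+1)).
  rewrite -exprM -!powR_mulrn ?powR_ge0 ?ler0n // -!powRrM -powRD; last first.
    by rewrite pnatr_eq0 -lt0n n0 implybT.
  rewrite le_eqVlt; apply/orP; left; apply/eqP; congr (_ `^ _).
  rewrite -[t.+1%:R]natr1 natrM; field.
  by rewrite t1.
rewrite ler_wpM2l ?exprn_ge0 //; apply: lerXn2r (hp); rewrite nnegrE ?powR_ge0 //.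
exact: le_trans (powR_ge0 _ _) hp.
Qed.

Theorem theorem1p4 (R : realType) (gamma alpha : R) (t r : nat)
    (G : forall n : nat, graph 'I_n) (p : nat -> R) (first : player)
    (hgamma : 0 < gamma) (ht : (2 <= t)%N) (hr : (2 <= r)%N)
    (halpha : (r%:R - 2) / (r%:R - 1) < alpha <= (r%:R - 1) / r%:R)
    (hG : \forall n \near \oo, alpha * n%:R <= (min_degree (G n))%:R)
    (hp01 : forall n : nat, 0 <= p n <= 1)
    (hp : \forall n \near \oo, n%:R `^ (- (2 / (t%:R + 1)) + gamma) <= p n) :
  gnp_prob (p n) (fun H : graph 'I_n =>
    maker_wins_clique first (G n :|: H) (t * r)) @[n --> \oo] --> (1 : R).
Proof.
have r2 : 2 <= r%:R :> R by rewrite ler_nat.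
have alpha1 : alpha <= 1.
  by have /andP[_ /le_trans] := halpha; apply; rewrite ler_pdivrMr; lra.
(* This is positive exactly when [alpha > (r - 2) / (r - 1)]. *)
pose eps : R := 1 - (r%:R - 1) * (1 - alpha).
have eps0 : 0 < eps.
  have /andP[] := halpha; rewrite ltr_pdivrMr; last by lra.
  by rewrite /eps => h _; lra.
pose d : R := (eps ^+ r) ^+ (t ^ r).
have d0 : 0 < d by rewrite !exprn_gt0.
pose K : R := ext_const R r t.
(* The other half of the density [d] absorbs the loss [(r * t) ^ 2 / n] to maps that are not
   injective, once [n] is large. *)
pose c := d / 2; have c0 : 0 < c by rewrite divr_gt0.
pose C : R := 4 * K / c + 8 * K + 1.
have C0 : 0 < C.
  have K0 : 0 <= K by exact: ler0n.
  have : 0 <= 4 * K / c by rewrite divr_ge0 ?mulr_ge0 // ltW.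
  by rewrite /C; lra.
(* With [mu = n ^ a] the cube of [mu] is the quantity [l] of the weight bounds. *)
pose a : R := gamma * (t%:R + 1) / 6.
have a0 : 0 < a by rewrite divr_gt0 // mulr_gt0 // natr1 ltr0n.
apply/cvgrPdist_le => e e0; near=> n.
have n0 : (0 < n)%N by near: n; exact: nbhs_infty_gt.
have n0' : 0 < n%:R :> R by rewrite ltr0n.
have hpn : n%:R `^ (- (2 / (t%:R + 1)) + gamma) <= p n by near: n.
have p0 : 0 < p n by apply: lt_le_trans hpn; apply: powR_gt0.
have pn01 : 0 < p n <= 1 by rewrite p0; have /andP[] := hp01 n.
have hGn : alpha * n%:R <= (min_degree (G n))%:R by near: n.
pose mu : R := n%:R `^ a.
have mu1 : 1 <= mu by rewrite /mu; near: n; apply: powR_near_ge.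
have mu_big : 2 ^+ (2 ^ (r * t)).+4 <= c * mu.
  rewrite mulrC -ler_pdivrMr // /mu; near: n; exact: powR_near_ge a0.
have mu_e : C / e <= mu by rewrite /mu; near: n; apply: powR_near_ge.
have n_big : (r * t)%:R ^+ 2 / c <= n%:R by near: n; exact: nbhs_infty_ger.
have dense := edge_probability_dense n0 hpn.
have cardI : #|'I_n| = n by rewrite card_ord.
have many : c * n%:R ^+ (r * t) <= #|@embeddings 'I_n r t (G n)|%:R.
  rewrite -ler_pdivlMr ?exprn_gt0 //.
  have := @embeddings_dense R alpha r t 'I_n (G n) (ltnW ht) (ltnW hr).
  rewrite cardI => /(_ n0 alpha1 (ltW eps0) hGn); apply: le_trans.
  rewrite -/eps -/d (_ : d = c + c); last by rewrite /c; field.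
  by rewrite -addrA lerDl subr_ge0 ler_pdivrMr // mulrC -ler_pdivrMr.
have bnd : expect (p n) (badness r t (G n) (p n) mu) <= C / mu.
  by apply: expect_badness => //; rewrite ?cardI.
have lo : 1 - C / mu <= gnp_prob (p n) (fun H : graph 'I_n =>
    maker_wins_clique first (G n :|: H) (t * r)).
  apply: le_trans (gnp_prob_ge pn01 _ _); last first.
  - by move=> H; apply: (@maker_wins_badness R 'I_n r t (G n) first (p n) mu c) => //; rewrite ?cardI.
  - by move=> H; apply: (@badness_ge0 R 'I_n r t (G n) (p n) mu c) => //; rewrite ?cardI.
  by rewrite lerD2l lerN2.
have mu0 : 0 < mu by apply: lt_le_trans mu1.
have Ce : C / mu <= e by rewrite ler_pdivrMr // mulrC -ler_pdivrMr.
have hi := gnp_prob_le1 pn01 (fun H : graph 'I_n =>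
    maker_wins_clique first (G n :|: H) (t * r)).
by rewrite ger0_norm ?subr_ge0 //; lra.
Unshelve. all: by end_near. Qed.
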